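(* For every $t \in (1,2)$ there exists a constant $A_{t} > 0$, depending only on $t$, such that the following holds. Let $\mu$ be a finite Borel measure on $B(1) \subset \mathbb{R}^{2}$, let $\nu$ be a finite Borel measure on $[\tfrac{1}{4},\tfrac{3}{4}] \times [-1,1]$, and let $\delta \in (0,1/50]$. Then $$\mathcal{I}_{\delta}(\mu,\nu) \leq A_{t} \cdot \delta \cdot \sqrt{I_{3-t}(\mu)\, I_{t}(\nu)}.$$
   Context: $B(1)$ is the closed unit ball of $\mathbb{R}^{2}$ centred at the origin. For $\theta \in [0,1]$ let $e_{\theta} = (\cos 2\pi\theta, \sin 2\pi\theta)$, $\pi_{\theta}(z) = z \cdot e_{\theta}$ for $z \in \mathbb{R}^{2}$, and for $r \in \mathbb{R}$ let $\ell_{\theta,r} = \pi_{\theta}^{-1}\{r\}$ (a line in $\mathbb{R}^{2}$). For $q = (\theta,r) \in [0,1] \times \mathbb{R}$ and $\delta > 0$, let $T_{q}(\delta) = \{z \in \mathbb{R}^{2} : \operatorname{dist}(z,\ell_{\theta,r}) \leq \delta\}$. For a finite Borel measure $\mu$ on $B(1)$ and a finite Borel measure $\nu$ on $[0,1] \times \mathbb{R}$, the weighted incidences are $$\mathcal{I}_{\delta}(\mu,\nu) := (\mu \times \nu)(\{(p,q) : p \in T_{q}(\delta)\}).$$ For $s \in (0,2)$, the $s$-dimensional Riesz energy is $I_{s}(\mu) = \iint |x-y|^{-s}\, d\mu(x)\, d\mu(y) \in [0,\infty]$, and likewise for $\nu$ as a measure on $\mathbb{R}^{2}$. *)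

(* Defs.v *)
From HB Require Import structures.
From mathcomp Require Import all_boot all_order all_algebra.
From mathcomp Require Import all_classical all_reals all_analysis.

Set Implicit Arguments.
Unset Strict Implicit.
Unset Printing Implicit Defensive.

Import Order.TTheory GRing.Theory Num.Theory.
Import numFieldNormedType.Exports.

Local Open Scope classical_set_scope.
Local Open Scope ring_scope.

(* The plane is R * R: its canonical sigma-algebra, the product of the Borel
   sigma-algebras of the two factors, is the Borel sigma-algebra of the plane.
   Its canonical norm, however, is the sup norm, so the Euclidean geometry is
   set up by hand. *)

Definition dot2 (R : realType) (z w : R * R) : R := z.1 * w.1 + z.2 * w.2.

Definition enorm2 (R : realType) (z : R * R) : R := Num.sqrt (dot2 z z).

Definition edist2 (R : realType) (z w : R * R) : R := enorm2 (z - w).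

(* Meant for nonempty A (the real infimum of the empty set is 0). *)
Definition dist_to (R : realType) (z : R * R) (A : set (R * R)) : R :=
  inf [set edist2 z w | w in A].

Definition unit_disc (R : realType) : set (R * R) := [set z | enorm2 z <= 1].
Arguments unit_disc : clear implicits.

Definition dir (R : realType) (theta : R) : R * R :=
  (cos (2 * pi * theta), sin (2 * pi * theta)).

Definition proj_dir (R : realType) (theta : R) (z : R * R) : R :=
  dot2 z (dir theta).

Definition line (R : realType) (q : R * R) : set (R * R) :=
  proj_dir q.1 @^-1` [set q.2].

Definition tube (R : realType) (delta : R) (q : R * R) : set (R * R) :=
  [set z | dist_to z (line q) <= delta].

Definition incidences (R : realType) (delta : R)
    (mu nu : {finite_measure set (R * R)%type -> \bar R}) : \bar R :=
  (mu \x nu)%E [set pq | tube delta pq.2 pq.1].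

(* The inverse is taken in \bar R, where 0^-1 = +oo: for s > 0 the kernel is
   +oo on the diagonal. *)
Definition riesz_kernel (R : realType) (s : R) (x y : R * R) : \bar R :=
  (((edist2 x y `^ s)%:E)^-1)%E.

Definition riesz_energy (R : realType) (s : R)
    (mu : {finite_measure set (R * R)%type -> \bar R}) : \bar R :=
  (\int[mu]_y \int[mu]_x riesz_kernel s x y)%E.

(* Main.v *)
Require Import Defs.
From HB Require Import structures.
From mathcomp Require Import all_boot all_order all_algebra.
From mathcomp Require Import all_classical all_reals all_analysis.
From mathcomp Require Import measurable_realfun.
From mathcomp Require Import zify ring lra.

Set Implicit Arguments.
Unset Strict Implicit.
Unset Printing Implicit Defensive.

Import Order.TTheory GRing.Theory Num.Theory.
Import numFieldNormedType.Exports.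

Local Open Scope classical_set_scope.
Local Open Scope ring_scope.

(** The estimate expresses a duality. In a chart a line is y = a x + b, so a
point p = (x, y) and a line q = (a, b) are incident at scale delta when
|y - a x - b| is at most of order delta: the lines through p fill a strip in
the (a, b)-plane. Let f be the superposition, weighted by mu, of bump functions
on these strips. Incidences are at most the pairing of f with the averages of
nu over boxes of side delta. Forming f is an X-ray transform, which smooths by
half a derivative: f lies in the Sobolev space of order (2 - t) / 2 with
squared norm of order at most delta^2 I_{3-t}(mu), while nu lies in the dual space
with squared norm of order at most I_t(nu).

Both norms are realised by dyadic sums. A box is the union of four translates
of a box of half its side, so passing from the averages of nu at scale 2^-k to
those at scale 2^-(k+1) costs exactly four pairings of f - f(. - v) with
averages of nu at scale 2^-(k+1), where v runs over the corners of the smaller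
box ([pairing_telescope]). Cauchy-Schwarz with weights 2^(k(2-t)) leaves two
sums. On the side of nu, averages at scale 2^-k only correlate lines closer
than 2^-k, and the sum of 2^(kt) over the scales 2^-k larger than d is of order
d^-t ([energyW_le]). On the side of mu, the correlation of f - f(. - v) at two
points at distance d is, up to delta^2, at most the smaller of 1/d and
2^-k / d^2 ([line_bump_diff]). The first bound is the area of the crossing of
two strips; the second is a cancellation: a translation by 2^-k moves the
crossing by only 2^-k / d along the strips. Since 0 < 2 - t < 1, the weighted
sum of these minima is of order d^-(3-t) ([sum_dyadic_min], [energyF_le]).

All of this takes place on an integer lattice. With delta comparable to 1 / P
for a power of two P, the coordinates x and a are rounded to multiples of P^-2
and y and b to multiples of P^-4, so that y - a x - b becomes an integer form
Y - A X - B and sums over the plane of lines are exactly translation invariant.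
The measures enter only through the masses of cells: the energies dominate the
discrete energies of these masses, and the incidences are dominated by the
discrete ones ([sum_cells_le_energy], [product_measure_le_cells]). The
discrete estimate is [discrete_incidence_le].

Two charts are used, each for a quarter turn of directions: the parameters 1/4
and 3/4 describe the same lines, so no single chart can be inverted by a
Lipschitz map, whereas on a quarter turn tan expands distances. *)

(** * Finite sums over the integers *)

Definition zrange (K : nat) : seq int := [seq i%:Z - K%:Z | i <- iota 0 (2 * K).+1].

Lemma mem_zrange K a : (a \in zrange K) = (`|a| <= K%:Z).
Proof.
apply/mapP/idP => [[i]|aK].
  by rewrite mem_iota => /andP[_ iK] ->; lia.
by exists (absz (a + K%:Z)); rewrite ?mem_iota; lia.
Qed.

Lemma zrange_uniq K : uniq (zrange K).
Proof. by rewrite map_inj_uniq ?iota_uniq// => i j /addIr[]. Qed.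

Lemma sum_support (V : eqType) (U : zmodType) (s : seq V) (g : V -> U) :
  \sum_(u <- s) g u = \sum_(u <- [seq u <- s | g u != 0]) g u.
Proof.
rewrite big_filter [RHS]big_mkcond/=; apply: eq_bigr => u _.
by case: eqP => // ->.
Qed.

(** Translation invariance: the finite window [s] has no effect as long as it
contains the supports of both summands. *)
Lemma sum_shift (V U : zmodType) (s : seq V) (g : V -> U) (v : V) : uniq s ->
  (forall u, g u != 0 -> u \in s) -> (forall u, g u != 0 -> u - v \in s) ->
  \sum_(u <- s) g (u + v) = \sum_(u <- s) g u.
Proof.
move=> us gs gvs.
rewrite -(big_map (+%R^~ v) xpredT g) sum_support [RHS]sum_support; apply: perm_big; apply: uniq_perm.
- by rewrite filter_uniq// map_inj_uniq//; exact: addIr.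
- by rewrite filter_uniq.
move=> u; rewrite !mem_filter; case: (boolP (g u != 0)) => //= gu0.
rewrite gs//; apply/mapP; exists (u - v); first exact: gvs.
by rewrite subrK.
Qed.

Lemma sum_zrange_le K (g : int -> int) (a0 c : int) (d : nat) : 0 <= c ->
  (forall a, g a <= c) -> (forall a, g a != 0 -> `|a - a0| <= d%:Z) ->
  \sum_(a <- zrange K) g a <= c * (2 * d%:Z + 1).
Proof.
move=> c0 gc gd.
rewrite sum_support.
apply: (@le_trans _ _ (\sum_(a <- [seq u <- zrange K | g u != 0]) c)).
  by apply: ler_sum.
rewrite big_const_seq count_predT iter_addr addr0 -[c *+ _]mulr_natr natz ler_wpM2l//.
set s := [seq u <- zrange K | g u != 0].
have : (size s <= size [seq (u + a0)%R | u <- zrange d])%N.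
  apply: uniq_leq_size; first by rewrite filter_uniq// zrange_uniq.
  move=> u; rewrite mem_filter => /andP[/gd ud _].
  by apply/mapP; exists (u - a0); rewrite ?mem_zrange ?subrK.
rewrite !size_map size_iota; lia.
Qed.

Lemma sum_zrange_diam_le K (g : int -> int) (c : int) (d : nat) : 0 <= c ->
  (forall a, g a <= c) ->
  (forall a b, g a != 0 -> g b != 0 -> `|a - b| <= d%:Z) ->
  \sum_(a <- zrange K) g a <= c * (2 * d%:Z + 1).
Proof.
move=> c0 gc gd.
have [/hasP[a _ ga]|/hasPn g0] := boolP (has (fun a => g a != 0) (zrange K)).
  by apply: (@sum_zrange_le _ _ a) => // b gb; exact: gd.
rewrite big1_seq; first by apply: mulr_ge0 => //; lia.
by move=> a /= /g0; rewrite negbK => /eqP.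
Qed.

(** The integers [a] with [|C - a * Z| <= E] lie in an interval of length
[2 * E / |Z|]; the inequality is multiplied by [|Z|] to avoid the division. *)
Lemma sum_zrange_progression_le K (g : int -> int) (c C Z E : int) : 0 <= c -> 0 <= E ->
  Z != 0 -> (forall a, g a <= c) ->
  (forall a, g a != 0 -> `|C - a * Z| <= E) ->
  `|Z| * \sum_(a <- zrange K) g a <= c * (4 * E + `|Z|).
Proof.
move=> c0 E0 Z0 gc gE.
have Zp : 0 < `|Z| by lia.
have dE : (2 * E %/ `|Z|)%Z * `|Z| <= 2 * E by rewrite lez_floor; lia.
have d0 : 0 <= (2 * E %/ `|Z|)%Z by rewrite divz_ge0; lia.
have [d dd] : exists d : nat, (2 * E %/ `|Z|)%Z = d%:Z.
  by exists (absz (2 * E %/ `|Z|)%Z); lia.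
have le : \sum_(a <- zrange K) g a <= c * (2 * d%:Z + 1).
  apply: sum_zrange_diam_le => // a b /gE ga /gE gb.
  rewrite -dd lez_divRL//; rewrite -normrM; nia.
apply: le_trans (ler_wpM2l (ltW Zp) le) _.
rewrite dd in dE; rewrite mulrCA ler_wpM2l//; nia.
Qed.

Section Correlation.
Variables (D : int) (K : nat).

Definition strip (n : int) : int := if `|n| <= D then 1 else 0.

Lemma strip_ge0 n : 0 <= strip n. Proof. by rewrite /strip; case: ifP. Qed.

Lemma strip_neq0 n : strip n != 0 -> `|n| <= D.
Proof. by rewrite /strip; case: ifP. Qed.

(** As soon as the window contains [[-D, D]], this is the tent function of
height [2 * D + 1] supported on [[-2 * D, 2 * D]]. *)
Definition autocorr (n : int) : int :=
  \sum_(B <- zrange K) strip (n - B) * strip (- B).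

Lemma autocorr_ge0 n : 0 <= autocorr n.
Proof. by apply: sumr_ge0 => B _; apply: mulr_ge0; exact: strip_ge0. Qed.

Lemma autocorr_neq0 n : autocorr n != 0 -> `|n| <= 2 * D.
Proof.
apply: contraNT => nD; rewrite /autocorr big1// => B _.
by rewrite /strip; do 2 (case: ifP => ?; rewrite ?mulr0 ?mul0r//); lia.
Qed.

(** A translation by [e] changes the indicator of [[-D, D]] only within distance
[|e|] of the two end points. *)
Lemma autocorr_lip (n e : int) : `|autocorr (n + e) - autocorr n| <= 6 * `|e|.
Proof.
have [->|e0] := eqVneq e 0; first by rewrite addr0 subrr.
have [d dE] : exists d : nat, `|e| = d%:Z by exists (absz e); lia.
pose near (c B : int) : int := if `|B - c| <= d%:Z then 1 else 0.
have nearS (c : int) : \sum_(B <- zrange K) near c B <= 1 * (2 * d%:Z + 1).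
  by apply: (@sum_zrange_le _ _ c) => // B; rewrite /near; case: ifP.
rewrite -sumrB; apply: le_trans (ler_norm_sum _ _ _) _.
apply: (@le_trans _ _ (\sum_(B <- zrange K) (near (n - D) B + near (n + D) B))).
  apply: ler_sum => B _; rewrite /near /strip.
  by repeat case: ifP => ?; lia.
rewrite big_split/=; apply: le_trans (lerD (nearS _) (nearS _)) _; lia.
Qed.

Lemma autocorr_le n : 0 < D -> autocorr n <= 3 * D.
Proof.
move=> D_gt0.
have [d dD] : exists d : nat, D = d%:Z by exists (absz D); lia.
apply: (@le_trans _ _ (1 * (2 * d%:Z + 1))); last by lia.
apply: (@sum_zrange_le _ _ 0) => // B.
  rewrite /strip; by do 2 case: ifP.
rewrite mulf_eq0 negb_or => /andP[_ /strip_neq0]; lia.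
Qed.

Lemma autocorr_shift a b : 0 <= D -> `|b| + D <= K%:Z ->
  \sum_(B <- zrange K) strip (a - B) * strip (b - B) = autocorr (a - b).
Proof.
move=> D_ge0 bK; pose g B := strip (a - b - B) * strip (- B).
rewrite /autocorr -[RHS](@sum_shift _ _ _ g (- b)) ?zrange_uniq//.
- by apply: eq_bigr => B _; rewrite /g; congr (strip _ * strip _); ring.
- move=> u; rewrite mem_zrange /g mulf_eq0 negb_or => /andP[_ /strip_neq0]; lia.
- move=> u; rewrite mem_zrange /g mulf_eq0 negb_or => /andP[_ /strip_neq0]; lia.
Qed.
End Correlation.

(** * Correlation of two strips in the plane of lines *)

(** The product of two constants in the basic overlap estimate: [27 * L] bounds
the height of the correlation of two intervals of half-length [9 * L], and
[74 * L] the number of slopes at which it does not vanish, times [|Z|]. *)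
HB.lock Definition kernel_const : int := 27 * 74.

Lemma kernel_constE : kernel_const = 27 * 74. Proof. by rewrite kernel_const.unlock. Qed.

Lemma kernel_const_ge0 : 0 <= kernel_const. Proof. by rewrite kernel_constE mulr_ge0. Qed.

Ltac nonneg := repeat (apply: mulr_ge0 || apply: exprn_ge0);
  first [exact: kernel_const_ge0 | done | lia].

(** A cutoff in the slope, Lipschitz so that translating it costs little, and
scaled by [Q] so that it takes integer values. *)
Definition tent (Q a : int) : int := if `|a| <= 3 * Q then 3 * Q - `|a| else 0.

Lemma tent_ge0 Q a : 0 <= tent Q a. Proof. rewrite /tent; case: ifP; lia. Qed.

Lemma tent_le Q a : 0 <= Q -> tent Q a <= 3 * Q. Proof. rewrite /tent; case: ifP; lia. Qed.

Lemma tent_neq0 Q a : tent Q a != 0 -> `|a| <= 3 * Q.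
Proof. by rewrite /tent; case: ifP. Qed.

Lemma tent_lip (Q a v : int) : `|tent Q (a + v) - tent Q a| <= `|v|.
Proof. rewrite /tent; do 2 case: ifP; lia. Qed.

Lemma tent_ge Q a : `|a| <= 2 * Q -> Q <= tent Q a.
Proof. rewrite /tent; case: ifP; lia. Qed.

Section LineKernel.
Variables (Q L : int) (K : nat).
Hypotheses (Q1 : 1 <= Q) (QL : Q <= L) (LQ : L <= Q ^+ 2) (KQ : 20 * Q ^+ 2 <= K%:Z).

Let D := 9 * L.
Let Q_ge0 : 0 <= Q. Proof. exact: le_trans Q1. Qed.

Let L_ge0 : 0 <= L. Proof. exact: le_trans QL. Qed.

Let D_gt0 : 0 < D. Proof. rewrite /D; lia. Qed.

(** A bump on the strip dual to the point [(X, Y)] in the plane of the lines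
[u = (A, B)]. Slopes are in units of [1 / Q] and intercepts in units of
[1 / Q ^ 2], so the strip has width [9 * delta] when [L = delta * Q ^ 2]. *)
Definition line_bump (X Y : int) (u : int * int) : int :=
  tent Q u.1 * strip (9 * L) (Y - u.1 * X - u.2).

Definition zbox : seq (int * int) := [seq (a, b) | a <- zrange K, b <- zrange K].

(** What is left of the correlation of two bumps after summation over the
intercept: the strips have slopes that differ by [Z], and [w] is the product of
the cutoffs. *)
Definition line_sum (w : int -> int) (C Z : int) : int :=
  \sum_(a <- zrange K) w a * autocorr (9 * L) K (C - a * Z).

Lemma line_bump_corr (X Y X' Y' v1 v2 v1' v2' : int) :
  `|X'| <= Q -> `|Y'| <= Q ^+ 2 -> `|v1'| <= Q -> `|v2'| <= Q ^+ 2 ->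
  \sum_(u <- zbox) line_bump X Y (u - (v1, v2)) * line_bump X' Y' (u - (v1', v2'))
  = line_sum (fun a => tent Q (a - v1) * tent Q (a - v1'))
      (Y - Y' + v1 * X - v1' * X' + v2 - v2') (X - X').
Proof.
move=> X'Q Y'Q v1'Q v2'Q.
rewrite /zbox big_allpairs_dep/=; apply: eq_bigr => a _.
rewrite /line_bump/=.
have [->|t0] := eqVneq (tent Q (a - v1')) 0.
  by rewrite mulr0 mul0r big1// => b _; rewrite mul0r mulr0.
transitivity (tent Q (a - v1) * tent Q (a - v1') * \sum_(b <- zrange K)
    (strip D (Y - (a - v1) * X + v2 - b) * strip D (Y' - (a - v1') * X' + v2' - b))).
  rewrite mulr_sumr; apply: eq_bigr => b _; rewrite mulrACA.
  by congr (_ * (strip _ _ * strip _ _)); ring.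
rewrite autocorr_shift ?(ltW D_gt0)//; first by congr (_ * autocorr _ _ _); ring.
have := tent_neq0 t0; set s := a - v1' => sQ.
have : `|s * X'| <= 3 * Q ^+ 2 by rewrite normrM; nia.
rewrite /D; lia.
Qed.

Lemma line_sum_ge0 (w : int -> int) (C Z : int) : (forall a, 0 <= w a) -> 0 <= line_sum w C Z.
Proof.
move=> w0; apply: sumr_ge0 => a _; apply: mulr_ge0 => //; exact: autocorr_ge0.
Qed.

(** Two strips whose slopes differ by [Z] only meet in an interval of length
of order [L / |Z|]. *)
Lemma line_sum_le (w : int -> int) (c C Z : int) :
  0 <= c -> `|Z| <= 2 * Q -> (forall a, `|w a| <= c) ->
  `|Z| * `|line_sum w C Z| <= kernel_const * c * L ^+ 2.
Proof.
move=> c0 ZQ wc; have [->|Z0] := eqVneq Z 0.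
  by rewrite normr0 mul0r; nonneg.
have H : `|Z| * \sum_(a <- zrange K) `|w a| * autocorr (9 * L) K (C - a * Z) <=
  c * (27 * L) * (4 * (18 * L) + `|Z|).
  apply: (@sum_zrange_progression_le _ _ _ C) => //; [nia|lia| |].
  - move=> a; have := autocorr_le K (C - a * Z) D_gt0.
    have := autocorr_ge0 D K (C - a * Z); rewrite -/D.
    move=> u0 u1; apply: ler_pM => //; apply: le_trans u1 _; rewrite /D; lia.
  - move=> a; rewrite mulf_eq0 negb_or => /andP[_ /autocorr_neq0]; rewrite /D; lia.
have H2 : `|line_sum w C Z| <= \sum_(a <- zrange K) `|w a| * autocorr (9 * L) K (C - a * Z).
  apply: le_trans (ler_norm_sum _ _ _) _; apply: ler_sum => a _.
  by rewrite normrM (ger0_norm (autocorr_ge0 _ _ _)).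
apply: le_trans (ler_wpM2l _ H2) _ => //; apply: le_trans H _.
apply: (@le_trans _ _ (c * (27 * L) * (74 * L))).
  by apply: ler_wpM2l; [nonneg|lia].
by rewrite le_eqVlt; apply/orP; left; apply/eqP; rewrite kernel_constE; ring.
Qed.

(** Nearly parallel strips with distant intercepts do not meet above the support
of the cutoff. *)
Lemma line_sum_eq0 (w : int -> int) (C Z : int) : (forall a, w a != 0 -> `|a| <= 3 * Q) ->
  18 * L + 3 * Q * `|Z| < `|C| -> line_sum w C Z = 0.
Proof.
move=> wQ CZ; rewrite /line_sum big1// => a _.
have [->|/wQ aQ] := eqVneq (w a) 0; first by rewrite mul0r.
have [->|/autocorr_neq0] := eqVneq (autocorr (9 * L) K (C - a * Z)) 0.
  by rewrite mulr0.
have : `|a * Z| <= 3 * Q * `|Z| by rewrite normrM ler_wpM2r.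
lia.
Qed.

Let tent2 a := tent Q a * tent Q a.

Let tent2_ge0 a : 0 <= tent2 a.
Proof. by apply: mulr_ge0; exact: tent_ge0. Qed.

Let tent2_le a : `|tent2 a| <= 9 * Q ^+ 2.
Proof.
rewrite ger0_norm ?tent2_ge0// /tent2; have := tent_ge0 Q a; have := tent_le a Q_ge0; nia.
Qed.

Let tent2_neq0 a : tent2 a != 0 -> `|a| <= 3 * Q.
Proof. by rewrite mulf_eq0 negb_or => /andP[_ /tent_neq0]. Qed.

(** If the strips meet at all then [|C|] is at most of order [L + Q * |Z|], and so
is the maximum. Multiplied by [L], the correlation is bounded trivially through
the support of the cutoff; multiplied by [Q * |Z|], by the crossing estimate. *)
Lemma line_sum_tent2_le (C Z : int) : `|Z| <= 2 * Q ->
  line_sum tent2 C Z * (Num.max (Num.max (Q * `|Z|) `|C|) L) <= 45 * kernel_const * Q ^+ 3 * L ^+ 2.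
Proof.
move=> ZQ; set W := line_sum _ _ _.
have W0 : 0 <= W by exact: line_sum_ge0.
have [CZ|CZ] := ltP (18 * L + 3 * Q * `|Z|) `|C|.
  by rewrite /W line_sum_eq0// mul0r; nonneg.
have HZ : `|Z| * W <= kernel_const * (9 * Q ^+ 2) * L ^+ 2.
  by rewrite -[W]ger0_norm// /W; apply: line_sum_le => //; nia.
have HL : W <= kernel_const * Q ^+ 3 * L.
  apply: (@le_trans _ _ (9 * Q ^+ 2 * (27 * L) * 7 * Q)); last first.
    have -> : 9 * Q ^+ 2 * (27 * L) * 7 * Q = 9 * 27 * 7 * (Q ^+ 3 * L) by ring.
    rewrite -[leRHS]mulrA ler_wpM2r//; first by nonneg.
    by rewrite kernel_constE; clear; lia.
  have [d dE] : exists d : nat, 3 * Q = d%:Z by exists (absz (3 * Q)); lia.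
  apply: (@le_trans _ _ (9 * Q ^+ 2 * (27 * L) * (2 * d%:Z + 1))).
    apply: (@sum_zrange_le _ _ 0); first nia.
      move=> a; have := autocorr_le K (C - a * Z) D_gt0.
      have := autocorr_ge0 D K (C - a * Z); rewrite -/D.
      move=> u0 u1; apply: ler_pM => //; first by have := tent2_le a; lia.
      by apply: le_trans u1 _; rewrite /D; lia.
    move=> a; rewrite mulf_eq0 negb_or => /andP[/tent2_neq0 + _]; lia.
  by rewrite -dE -[leRHS]mulrA ler_wpM2l//; nia.
have : Num.max (Num.max (Q * `|Z|) `|C|) L <= 18 * L + 3 * Q * `|Z| by lia.
move=> /(ler_wpM2l W0)/le_trans; apply.
have -> : W * (18 * L + 3 * Q * `|Z|) = (18 * L) * W + 3 * Q * (`|Z| * W) by ring.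
have L0 : 0 <= 18 * L by lia.
have Q0 : 0 <= 3 * Q by lia.
apply: le_trans (lerD (ler_wpM2l L0 HL) (ler_wpM2l Q0 HZ)) _.
have -> : 18 * L * (kernel_const * Q ^+ 3 * L) + 3 * Q * (kernel_const * (9 * Q ^+ 2) * L ^+ 2) =
  45 * kernel_const * Q ^+ 3 * L ^+ 2 by ring.
by [].
Qed.

(** [Q ^ 2] times the distance of the points [(X / Q, Y / Q ^ 2)] and
[(X' / Q, Y' / Q ^ 2)], cut off below at the resolution [L / Q ^ 2]. *)
Definition gap (X Y X' Y' : int) : int :=
  Num.max (Num.max (Q * `|X - X'|) `|Y - Y'|) L.

Lemma line_bump_self (X Y X' Y' : int) :
  `|X| <= Q -> `|Y| <= Q ^+ 2 -> `|X'| <= Q -> `|Y'| <= Q ^+ 2 ->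
  (\sum_(u <- zbox) line_bump X Y u * line_bump X' Y' u) * gap X Y X' Y' <=
  45 * kernel_const * Q ^+ 3 * L ^+ 2.
Proof.
move=> XQ YQ X'Q Y'Q.
have sub00 (u : int * int) : u - (0, 0) = u by rewrite -[(0, 0)]/(0 : int * int)%R subr0.
have -> : \sum_(u <- zbox) line_bump X Y u * line_bump X' Y' u =
    line_sum tent2 (Y - Y') (X - X').
  transitivity (\sum_(u <- zbox) line_bump X Y (u - (0, 0)) * line_bump X' Y' (u - (0, 0))).
    by apply: eq_bigr => u _; rewrite sub00.
  rewrite line_bump_corr// ?normr0//; try nia.
  by rewrite !mul0r !subr0 ?addr0; apply: eq_bigr => a _; rewrite /tent2 ?subr0.
by apply: line_sum_tent2_le; lia.
Qed.

Section Difference.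
Variable h : int.
Hypotheses (h0 : 0 <= h) (hQ : h <= Q) (LhQ : L <= h * Q) (QhL : Q ^+ 2 <= h * L).

Lemma tent2_shift_le (a m : int) : `|tent2 (a + m) - tent2 a| <= 6 * Q * `|m|.
Proof.
have -> : tent2 (a + m) - tent2 a =
    (tent Q (a + m) - tent Q a) * (tent Q (a + m) + tent Q a) by rewrite /tent2; ring.
rewrite normrM [leRHS]mulrC ler_pM//; first exact: tent_lip.
have := tent_ge0 Q a; have := tent_ge0 Q (a + m); have := tent_le a Q_ge0; have := tent_le (a + m) Q_ge0.
lia.
Qed.

(** An offset by [m * Z] is a translation of the slope variable by [m]. *)
Lemma line_sum_slide (C Z m : int) : `|m| <= 5 * Q ^+ 2 ->
  line_sum tent2 (C + m * Z) Z = line_sum (fun a => tent2 (a + m)) C Z.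
Proof.
move=> mQ; pose g a := tent2 a * autocorr (9 * L) K (C + m * Z - a * Z).
transitivity (\sum_(a <- zrange K) g (a + m)).
  rewrite sum_shift ?zrange_uniq// => u;
    rewrite mem_zrange mulf_eq0 negb_or => /andP[/tent2_neq0 + _]; nia.
by apply: eq_bigr => a _; rewrite /g; congr (_ * autocorr _ _ _); ring.
Qed.

(** The rounding error made when an offset is replaced by a multiple of [Z]: the
correlation is Lipschitz, and only the slopes at which the strips meet count. *)
Lemma line_sum_jitter (C e Z : int) : Z != 0 -> `|Z| <= 2 * Q -> `|e| <= `|Z| ->
  `|Z| * `|line_sum tent2 (C + e) Z - line_sum tent2 C Z| <=
  54 * Q ^+ 2 * `|Z| * (82 * L).
Proof.
move=> Z0 ZQ eZ; rewrite /line_sum -sumrB.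
pose g a := `|tent2 a * (autocorr (9 * L) K (C + e - a * Z) - autocorr (9 * L) K (C - a * Z))|.
have H : `|Z| * \sum_(a <- zrange K) g a <=
    54 * Q ^+ 2 * `|Z| * (4 * (18 * L + `|Z|) + `|Z|).
  apply: (@sum_zrange_progression_le _ _ _ C) => //; [nia|lia| |].
  - move=> a; rewrite /g normrM.
    have -> : 54 * Q ^+ 2 * `|Z| = 9 * Q ^+ 2 * (6 * `|Z|) by ring.
    apply: ler_pM => //.
    have := autocorr_lip D K (C - a * Z) e.
    by rewrite /D addrAC => /le_trans; apply; lia.
  - move=> a; rewrite normr_eq0 mulf_eq0 negb_or => /andP[_ H].
    have [C1|C1] := eqVneq (autocorr (9 * L) K (C - a * Z)) 0.
      move: H; rewrite C1 subr0 => /autocorr_neq0; rewrite /D; lia.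
    by move: C1 => /autocorr_neq0; rewrite /D; lia.
apply: (@le_trans _ _ (`|Z| * \sum_(a <- zrange K) g a)).
  rewrite ler_wpM2l//; apply: le_trans (ler_norm_sum _ _ _) _.
  by apply: ler_sum => a _; rewrite /g mulrBr.
apply: le_trans H _; rewrite ler_wpM2l//; first by nia.
lia.
Qed.

(** The cancellation. The offset [C - C0] is [m * Z + e] with [0 <= e < |Z|].
The part [m * Z] is a translation of the slope by [m], at most of order
[h * Q / |Z|], which is absorbed by the Lipschitz weight [tent2]; [e] is
absorbed by [line_sum_jitter]. The change of weight and the translation gain a
factor of order [h / |Z|] over the crossing estimate, and so does the rounding
because [Q ^ 2 <= h * L]. *)
Lemma line_sum_diff (w : int -> int) (C C0 Z : int) : Z != 0 -> `|Z| <= 2 * Q ->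
  (forall a, `|w a - tent2 a| <= 3 * Q * h) -> `|C - C0| <= 2 * h * Q ->
  `|Z| ^+ 2 * `|line_sum w C Z - line_sum tent2 C0 Z| <=
  39 * kernel_const * h * Q ^+ 2 * L ^+ 2.
Proof.
move=> Z0 ZQ wt CC0.
set m := ((C - C0) %/ Z)%Z; set e := ((C - C0) %% Z)%Z.
have CE : C = C0 + e + m * Z by rewrite /m /e; have := divz_eq (C - C0) Z; lia.
have e0 : 0 <= e by rewrite modz_ge0.
have eZ : e < `|Z| by rewrite ltz_mod.
have Zp : 0 < `|Z| by lia.
have mZ : `|m| * `|Z| <= 4 * h * Q.
  rewrite -normrM; have -> : m * Z = C - C0 - e by lia.
  have : Q <= h * Q by nia.
  by lia.
have mQ : `|m| <= 5 * Q ^+ 2.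
  have : `|m| <= `|m| * `|Z| by rewrite ler_peMr.
  nia.
set W := line_sum w C Z; set W0 := line_sum _ _ _.
have T1 : `|Z| * `|W - line_sum tent2 C Z| <= kernel_const * (3 * Q * h) * L ^+ 2.
  rewrite /W /line_sum -sumrB.
  under eq_bigr do rewrite -mulrBl.
  by apply: line_sum_le => //; nia.
have T2 : `|Z| * `|line_sum tent2 C Z - line_sum tent2 (C0 + e) Z| <=
    kernel_const * (6 * Q * `|m|) * L ^+ 2.
  rewrite CE line_sum_slide// /line_sum -sumrB.
  under eq_bigr do rewrite -mulrBl.
  by apply: line_sum_le => //; [nia|move=> a; exact: tent2_shift_le].
have T3 : `|Z| * `|line_sum tent2 (C0 + e) Z - W0| <= 54 * Q ^+ 2 * `|Z| * (82 * L).
  by apply: line_sum_jitter => //; lia.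
have T : `|W - W0| <= `|W - line_sum tent2 C Z| +
    `|line_sum tent2 C Z - line_sum tent2 (C0 + e) Z| + `|line_sum tent2 (C0 + e) Z - W0|.
  lia.
move: T1 T2 T3 T; move: (`|W - W0|) (`|W - _|) (`|_ - line_sum tent2 (C0 + e) Z|) (`|_ - W0|).
move=> x a b c T1 T2 T3 T.
have zz : `|Z| ^+ 2 * x <= `|Z| * (`|Z| * a + `|Z| * b + `|Z| * c).
  have -> : `|Z| * (`|Z| * a + `|Z| * b + `|Z| * c) = `|Z| ^+ 2 * (a + b + c) by ring.
  by rewrite ler_wpM2l// exprn_ge0.
apply: le_trans zz _; rewrite !mulrDr.
have L2 : 0 <= L ^+ 2 by apply: exprn_ge0; lia.
have hQ2 : 0 <= h * Q ^+ 2 * L ^+ 2 by nonneg.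
have A1 : `|Z| * (`|Z| * a) <= 6 * kernel_const * (h * Q ^+ 2 * L ^+ 2).
  apply: le_trans (ler_wpM2l (ltW Zp) T1) _.
  have -> : `|Z| * (kernel_const * (3 * Q * h) * L ^+ 2) = `|Z| * (kernel_const * 3 * (Q * h * L ^+ 2)) by ring.
  have -> : 6 * kernel_const * (h * Q ^+ 2 * L ^+ 2) = 2 * Q * (kernel_const * 3 * (Q * h * L ^+ 2)) by ring.
  by rewrite ler_wpM2r//; nonneg.
have A2 : `|Z| * (`|Z| * b) <= 24 * kernel_const * (h * Q ^+ 2 * L ^+ 2).
  apply: le_trans (ler_wpM2l (ltW Zp) T2) _.
  have -> : `|Z| * (kernel_const * (6 * Q * `|m|) * L ^+ 2) =
    `|m| * `|Z| * (kernel_const * 6 * (Q * L ^+ 2)) by ring.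
  have -> : 24 * kernel_const * (h * Q ^+ 2 * L ^+ 2) = 4 * h * Q * (kernel_const * 6 * (Q * L ^+ 2)) by ring.
  by rewrite ler_wpM2r//; nonneg.
have A3 : `|Z| * (`|Z| * c) <= 9 * kernel_const * (h * Q ^+ 2 * L ^+ 2).
  apply: le_trans (ler_wpM2l (ltW Zp) T3) _.
  have -> : `|Z| * (54 * Q ^+ 2 * `|Z| * (82 * L)) =
    (`|Z| * `|Z|) * (54 * 82 * (Q ^+ 2 * L)) by ring.
  apply: (@le_trans _ _ (2 * Q * (2 * Q) * (54 * 82 * (Q ^+ 2 * L)))).
    by rewrite ler_wpM2r ?ler_pM//; nonneg.
  have -> : 2 * Q * (2 * Q) * (54 * 82 * (Q ^+ 2 * L)) =
    54 * 82 * 4 * (Q ^+ 2 * L * Q ^+ 2) by ring.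
  have -> : 9 * kernel_const * (h * Q ^+ 2 * L ^+ 2) = 9 * kernel_const * (Q ^+ 2 * L * (h * L)) by ring.
  apply: ler_pM; [nonneg|nonneg| |].
    by rewrite kernel_constE; clear; lia.
  by rewrite ler_wpM2l//; nonneg.
apply: le_trans (lerD (lerD A1 A2) A3) _.
have -> : 39 * kernel_const * h * Q ^+ 2 * L ^+ 2 = 39 * kernel_const * (h * Q ^+ 2 * L ^+ 2) by ring.
by rewrite -!mulrDl.
Qed.

(** The product expands into twice the correlation of the two bumps minus two
cross terms. The cross terms are nonnegative, whence the first bound. When the
points are at distance much larger than the translation they are close to the
correlation itself, whence the second bound; otherwise it follows from the
first. *)
Lemma line_bump_diff (X Y X' Y' v1 v2 : int) :
  `|X| <= Q -> `|Y| <= Q ^+ 2 -> `|X'| <= Q -> `|Y'| <= Q ^+ 2 ->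
  `|v1| <= h -> `|v2| <= h * Q ->
  let r := gap X Y X' Y' in
  let g := \sum_(u <- zbox)
    (line_bump X Y u - line_bump X Y (u - (v1, v2))) *
    (line_bump X' Y' u - line_bump X' Y' (u - (v1, v2))) in
  g * r <= 90 * kernel_const * Q ^+ 3 * L ^+ 2 /\
  g * r ^+ 2 <= 40 * (90 * kernel_const) * h * Q ^+ 4 * L ^+ 2.
Proof.
move=> XQ YQ X'Q Y'Q v1h v2h r g.
have v1Q : `|v1| <= Q by lia.
have v2Q : `|v2| <= Q ^+ 2 by nia.
set Z := X - X'; set W := line_sum tent2 (Y - Y') Z.
have W0 : 0 <= W by exact: line_sum_ge0.
pose w1 a := tent Q a * tent Q (a - v1).
pose w2 a := tent Q (a - v1) * tent Q a.
pose C1 := Y - Y' - v1 * X' - v2.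
pose C2 := Y - Y' + v1 * X + v2.
have gE : g = W + W - line_sum w1 C1 Z - line_sum w2 C2 Z.
  rewrite /g; under eq_bigr do rewrite mulrBl !mulrBr.
  rewrite !sumrB opprB.
  have sub00 (u : int * int) : u - (0, 0) = u by rewrite -[(0, 0)]/(0 : int * int)%R subr0.
  have -> : \sum_(u <- zbox) line_bump X Y u * line_bump X' Y' u = W.
    transitivity (\sum_(u <- zbox) line_bump X Y (u - (0, 0)) * line_bump X' Y' (u - (0, 0))).
      by apply: eq_bigr => u _; rewrite sub00.
    rewrite line_bump_corr// ?normr0//; try nia.
    rewrite !mul0r !subr0 ?addr0; apply: eq_bigr => a _; by rewrite !subr0.
  have -> : \sum_(u <- zbox) line_bump X Y u * line_bump X' Y' (u - (v1, v2)) = line_sum w1 C1 Z.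
    transitivity (\sum_(u <- zbox) line_bump X Y (u - (0, 0)) * line_bump X' Y' (u - (v1, v2))).
      by apply: eq_bigr => u _; rewrite sub00.
    rewrite line_bump_corr// mul0r !addr0; apply: eq_bigr => a _; by rewrite subr0.
  have -> : \sum_(u <- zbox) line_bump X Y (u - (v1, v2)) * line_bump X' Y' u = line_sum w2 C2 Z.
    transitivity (\sum_(u <- zbox) line_bump X Y (u - (v1, v2)) * line_bump X' Y' (u - (0, 0))).
      by apply: eq_bigr => u _; rewrite sub00.
    rewrite line_bump_corr// ?normr0//; try nia.
    rewrite mul0r !subr0; apply: eq_bigr => a _; by rewrite subr0.
  have -> : \sum_(u <- zbox) line_bump X Y (u - (v1, v2)) * line_bump X' Y' (u - (v1, v2)) = W.
    rewrite line_bump_corr//.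
    have -> : Y - Y' + v1 * X - v1 * X' + v2 - v2 = Y - Y' + v1 * Z by rewrite /Z; ring.
    rewrite -/Z; transitivity (line_sum (fun a => tent2 (a + - v1)) (Y - Y' + v1 * Z) Z) => //.
    rewrite -line_sum_slide; last by rewrite normrN; nia.
    by congr line_sum; ring.
  ring.
have w1_ge0 a : 0 <= w1 a by apply: mulr_ge0; exact: tent_ge0.
have w2_ge0 a : 0 <= w2 a by apply: mulr_ge0; exact: tent_ge0.
have gW : g <= 2 * W.
  have := @line_sum_ge0 w1 C1 Z w1_ge0; have := @line_sum_ge0 w2 C2 Z w2_ge0.
  rewrite gE; lia.
have ZQ : `|Z| <= 2 * Q by rewrite /Z; lia.
have r0 : 0 <= r by rewrite /r /gap; lia.
have HA : g * r <= 90 * kernel_const * Q ^+ 3 * L ^+ 2.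
  apply: le_trans (ler_wpM2r r0 gW) _.
  have := line_sum_tent2_le (Y - Y') ZQ; rewrite -/W -/(gap X Y X' Y') -/r.
  have -> : 90 * kernel_const * Q ^+ 3 * L ^+ 2 = 2 * (45 * kernel_const * Q ^+ 3 * L ^+ 2) by ring.
  by move=> H; rewrite -[leLHS]mulrA; apply: ler_wpM2l.
split=> //.
(* Points closer than a multiple of the translation: no cancellation. *)
have [rh|rh] := ltP r (40 * h * Q).
  have [g0|g0] := ltP g 0.
    apply: (@le_trans _ _ 0); last by nonneg.
    by apply: mulr_le0_ge0; [exact: ltW|exact: exprn_ge0].
  rewrite expr2 mulrA.
  apply: (@le_trans _ _ (90 * kernel_const * Q ^+ 3 * L ^+ 2 * (40 * h * Q))).
    apply: ler_pM => //; last exact: ltW.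
    exact: mulr_ge0.
  by rewrite le_eqVlt; apply/orP; left; apply/eqP; move: (90 * kernel_const) => B; ring.
have P0 : 0 <= 40 * (90 * kernel_const) * h * Q ^+ 4 * L ^+ 2.
  by nonneg.
have C1d : `|C1 - (Y - Y')| <= 2 * h * Q.
  have : `|v1 * X'| <= h * Q by rewrite normrM ler_pM.
  by rewrite /C1; lia.
have C2d : `|C2 - (Y - Y')| <= 2 * h * Q.
  have : `|v1 * X| <= h * Q by rewrite normrM ler_pM.
  by rewrite /C2; lia.
(* Either no pair of translated strips meets, or the distance of the points is
   comparable to their horizontal distance [Z]. *)
have [YZ|YZ] := ltP (18 * L + 3 * Q * `|Z| + 2 * h * Q) `|Y - Y'|.
  suff -> : g = 0 by rewrite mul0r.
  have hQ0 : 0 <= h * Q by rewrite mulr_ge0//; lia.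
  have Y0 : 18 * L + 3 * Q * `|Z| < `|Y - Y'| by clear -YZ hQ0; lia.
  have Y1 : 18 * L + 3 * Q * `|Z| < `|C1| by clear -YZ hQ0 C1d; lia.
  have Y2 : 18 * L + 3 * Q * `|Z| < `|C2| by clear -YZ hQ0 C2d; lia.
  rewrite gE /W !line_sum_eq0//.
  - by move=> a; rewrite mulf_eq0 negb_or => /andP[_ /tent_neq0].
  - by move=> a; rewrite mulf_eq0 negb_or => /andP[/tent_neq0].
have rZ : r <= 6 * (Q * `|Z|).
  have QZ0 : 0 <= Q * `|Z| by rewrite mulr_ge0//; lia.
  move: rh YZ LhQ QZ0; rewrite /r /gap -/Z -!mulrA.
  by move: (h * Q) (Q * `|Z|) `|Y - Y'| => x y z; clear; lia.
have Z0 : Z != 0.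
  apply/eqP => Z0; have : 0 < h * Q by apply: lt_le_trans LhQ; clear -Q1 QL; lia.
  move: rZ rh; rewrite Z0 normr0 !mulr0 -mulrA; move: (h * Q) => x; clear; lia.
have w1d a : `|w1 a - tent2 a| <= 3 * Q * h.
  have -> : w1 a - tent2 a = tent Q a * (tent Q (a + - v1) - tent Q a).
    by rewrite /w1 /tent2 mulrBr.
  rewrite normrM ler_pM//; first by rewrite ger0_norm ?tent_ge0 ?tent_le.
  by apply: le_trans (tent_lip _ _ _) _; rewrite normrN.
have w2d a : `|w2 a - tent2 a| <= 3 * Q * h.
  by have := w1d a; rewrite /w1 /w2 mulrC.
have D1 := line_sum_diff Z0 ZQ w1d C1d.
have D2 := line_sum_diff Z0 ZQ w2d C2d.
rewrite -/W in D1 D2.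
have gZ : `|Z| ^+ 2 * g <= 78 * kernel_const * h * Q ^+ 2 * L ^+ 2.
  have -> : 78 * kernel_const * h * Q ^+ 2 * L ^+ 2 =
    39 * kernel_const * h * Q ^+ 2 * L ^+ 2 + 39 * kernel_const * h * Q ^+ 2 * L ^+ 2 by ring.
  apply: le_trans (lerD D1 D2); rewrite -mulrDr ler_wpM2l ?exprn_ge0//.
  by rewrite gE; clear; lia.
have [g0|g0] := ltP g 0.
  by apply: le_trans P0; apply: mulr_le0_ge0; [exact: ltW|exact: exprn_ge0].
apply: (@le_trans _ _ (g * (6 * (Q * `|Z|)) ^+ 2)).
  by rewrite ler_wpM2l// lerXn2r// nnegrE//; nonneg.
have -> : g * (6 * (Q * `|Z|)) ^+ 2 = 36 * Q ^+ 2 * (`|Z| ^+ 2 * g) by ring.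
apply: (@le_trans _ _ (36 * Q ^+ 2 * (78 * kernel_const * h * Q ^+ 2 * L ^+ 2))).
  by rewrite ler_wpM2l//; nonneg.
have -> : 36 * Q ^+ 2 * (78 * kernel_const * h * Q ^+ 2 * L ^+ 2) =
  36 * (78 * kernel_const) * (h * Q ^+ 4 * L ^+ 2) by move: (78 * kernel_const) => B; ring.
have -> : 40 * (90 * kernel_const) * h * Q ^+ 4 * L ^+ 2 =
  40 * (90 * kernel_const) * (h * Q ^+ 4 * L ^+ 2) by rewrite !mulrA.
apply: ler_wpM2r; first by nonneg.
by have := kernel_const_ge0; clear; lia.
Qed.
End Difference.
End LineKernel.

(** * Boxes in the plane of lines *)

Definition segment_ind (s n : int) : int := if (0 <= n) && (n < s) then 1 else 0.

Lemma segment_ind_ge0 s n : 0 <= segment_ind s n. Proof. by rewrite /segment_ind; case: ifP. Qed.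

Lemma segment_ind_neq0 s n : segment_ind s n != 0 -> (0 <= n) && (n < s).
Proof. by rewrite /segment_ind; case: ifP. Qed.

Lemma sum_segment_ind K (A s : int) : 0 <= s -> `|A| + s <= K%:Z ->
  \sum_(a <- zrange K) segment_ind s (A - a) = s.
Proof.
move=> s0 AK; have [n sn] : exists n : nat, s = n%:Z by exists (absz s); lia.
rewrite sum_support.
set F := [seq a <- zrange K | _].
have FE : perm_eq F [seq A - i%:Z | i <- iota 0 n].
  apply: uniq_perm; first by rewrite filter_uniq// zrange_uniq.
    by rewrite map_inj_uniq ?iota_uniq// => i j /addrI/oppr_inj[].
  move=> a; rewrite mem_filter mem_zrange; apply/idP/mapP.
    move=> /andP[/segment_ind_neq0 + _]; rewrite sn => ?.
    by exists (absz (A - a)); rewrite ?mem_iota; lia.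
  by case=> i; rewrite mem_iota => /andP[_ ?] ->; rewrite /segment_ind; case: ifP; lia.
rewrite (perm_big _ FE) big_map (eq_big_seq (fun=> 1)); last first.
  by move=> i; rewrite mem_iota /segment_ind; case: ifP; lia.
by rewrite big_const_seq count_predT size_iota iter_addr addr0 natz sn.
Qed.

Lemma segment_ind_double s n : 0 <= s -> segment_ind (2 * s) n = segment_ind s n + segment_ind s (n - s).
Proof. by rewrite /segment_ind => s0; repeat case: ifP; lia. Qed.

Definition box_ind (s s' : int) (w : int * int) : int := segment_ind s w.1 * segment_ind s' w.2.

Lemma box_ind_ge0 s s' w : 0 <= box_ind s s' w.
Proof. by apply: mulr_ge0; exact: segment_ind_ge0. Qed.

Lemma box_ind_le1 s s' w : box_ind s s' w <= 1.
Proof. by rewrite /box_ind /segment_ind; repeat case: ifP. Qed.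

Lemma box_ind_neq0 s s' w : box_ind s s' w != 0 ->
  [&& 0 <= w.1, w.1 < s, 0 <= w.2 & w.2 < s'].
Proof. by rewrite mulf_eq0 negb_or => /andP[/segment_ind_neq0/andP[-> ->] /segment_ind_neq0/andP[-> ->]]. Qed.

Definition corners (s s' : int) : seq (int * int) := [:: (0, 0); (s, 0); (0, s'); (s, s')].

(** This partition is exact, which makes the multiscale decomposition of a
pairing a telescoping sum without remainder. *)
Lemma box_ind_double s s' w : 0 <= s -> 0 <= s' ->
  box_ind (2 * s) (2 * s') w = \sum_(v <- corners s s') box_ind s s' (w - v).
Proof.
move=> s0 s'0; rewrite /box_ind !segment_ind_double// !big_cons big_nil/= !subr0; ring.
Qed.

Lemma sum_box_ind K (A B s s' : int) : 0 <= s -> 0 <= s' ->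
  `|A| + s <= K%:Z -> `|B| + s' <= K%:Z ->
  \sum_(u <- zbox K) box_ind s s' ((A, B) - u) = s * s'.
Proof.
move=> s0 s'0 AK BK.
rewrite /zbox big_allpairs_dep/= /box_ind.
transitivity (\sum_(a <- zrange K) segment_ind s (A - a) * s'); last first.
  by rewrite -mulr_suml sum_segment_ind.
by apply: eq_bigr => a _; rewrite -[in RHS](sum_segment_ind s'0 BK) mulr_sumr.
Qed.

Lemma mem_zbox K u : (u \in zbox K) = (`|u.1| <= K%:Z) && (`|u.2| <= K%:Z).
Proof.
case: u => a b; rewrite -!mem_zrange; apply/allpairsPdep/andP.
  by case=> a' [b' [? ? [-> ->]]].
by move=> /= [? ?]; exists a, b.
Qed.

Lemma zbox_uniq K : uniq (zbox K).
Proof. by apply: allpairs_uniq; rewrite ?zrange_uniq// => -[a b] [a' b']. Qed.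

(** * Dyadic sums *)

Section Dyadic.
Variable R : realType.
Implicit Types (a c d e x : R).

Lemma powR2_exp e k : (2 `^ e) ^+ k = (2 ^+ k) `^ e.
Proof.
by rewrite -(powR_mulrn k (powR_ge0 2 e)) -(powR_mulrn k (ler0n R 2)) -!powRrM mulrC.
Qed.

Let powR1e e : 1 `^ e = 1 :> R. Proof. by rewrite powR1. Qed.

Lemma powR_gt1 e : 0 < e -> 1 < 2 `^ e.
Proof. by move=> e0; rewrite -[ltLHS](powR1e e) gt0_ltr_powR ?nnegrE ?ltr1n. Qed.

Lemma powRN_lt1 e : 0 < e -> 2 `^ (- e) < 1.
Proof. by move=> e0; rewrite powRN invf_lt1 ?powR_gt1// (lt_trans _ (powR_gt1 e0)). Qed.

Lemma sum_geometric_le a n : 1 < a -> \sum_(k < n) a ^+ k <= a ^+ n / (a - 1).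
Proof.
move=> a1; rewrite ler_pdivlMr ?subr_gt0// mulrC -subrX1 lerBlDr lerDl//.
Qed.

(** An increasing geometric sum is comparable to its last term, for which
[2 ^ k] is about [1 / d]. *)
Lemma sum_dyadic_low e d n : 0 < e -> 0 < d ->
  \sum_(k < n | d * 2 ^+ k <= 1) (2 `^ e) ^+ k <= 2 `^ e / (2 `^ e - 1) * d `^ (- e).
Proof.
move=> e0 d0; have a1 := powR_gt1 e0.
have C0 : 0 < 2 `^ e / (2 `^ e - 1) by rewrite divr_gt0 ?subr_gt0// (lt_trans _ a1).
elim: n => [|n IH]; first by rewrite big_ord0 mulr_ge0 ?powR_ge0 ?ltW.
have [dn|dn] := boolP (d * 2 ^+ n <= 1).
  apply: (@le_trans _ _ (\sum_(k < n.+1) (2 `^ e) ^+ k)).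
    rewrite big_mkcond; apply: ler_sum => k _.
    by case: ifP => _ //; rewrite exprn_ge0 ?powR_ge0.
  apply: le_trans (sum_geometric_le _ a1) _.
  rewrite exprS mulrAC; apply: ler_wpM2l; first exact: ltW.
  rewrite powR2_exp powRN -[leRHS]div1r.
  rewrite ler_pdivlMr ?powR_gt0// -powRM ?exprn_ge0 ?(ltW d0)// mulrC.
  by rewrite -[leRHS](powR1e e) ge0_ler_powR ?nnegrE ?mulr_ge0 ?exprn_ge0 ?(ltW d0) ?(ltW e0).
by rewrite big_mkcond big_ord_recr/= (negbTE dn) addr0 -big_mkcond.
Qed.

(** A decreasing geometric sum is comparable to its first term, for which
[2 ^ k] is about [1 / d]. *)
Lemma sum_dyadic_high e d n : 0 < e -> 0 < d ->
  \sum_(k < n | 1 < d * 2 ^+ k) (2 `^ (- e)) ^+ k <= d `^ e / (1 - 2 `^ (- e)).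
Proof.
move=> e0 d0; have c1 := powRN_lt1 e0; set c := 2 `^ (- e) in c1 *.
have c0 : 0 <= c by exact: powR_ge0.
(* The induction keeps room for the tail [c ^+ n / (1 - c)]; the maximum
   covers the case where no scale has been reached yet. *)
suff H : \sum_(k < n | 1 < d * 2 ^+ k) c ^+ k <=
    (Num.max (d `^ e) (c ^+ n) - c ^+ n) / (1 - c).
  apply: le_trans H _; rewrite ler_pM2r ?invr_gt0 ?subr_gt0//.
  by rewrite lerBlDr ge_max lerDl exprn_ge0//= lerDr powR_ge0.
have key k : (1 < d * 2 ^+ k) = (c ^+ k < d `^ e).
  rewrite /c powR2_exp powRN -div1r ltr_pdivrMr ?powR_gt0 ?exprn_gt0//.
  rewrite -powRM ?exprn_ge0 ?(ltW d0)//; apply/idP/idP => H.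
    by rewrite -[ltLHS](powR1e e) gt0_ltr_powR ?nnegrE ?mulr_ge0 ?exprn_ge0 ?(ltW d0).
  rewrite ltNge; apply/negP => H'; move: H; rewrite ltNge => /negP; apply.
  by rewrite -[leRHS](powR1e e) ge0_ler_powR ?nnegrE ?mulr_ge0 ?exprn_ge0 ?(ltW d0) ?(ltW e0).
elim: n => [|n IH].
  by rewrite big_ord0 divr_ge0 ?subr_ge0 ?(ltW c1)// le_max lexx orbT.
have cn : c ^+ n.+1 <= c ^+ n by rewrite exprS ler_piMl ?exprn_ge0// ltW.
rewrite big_mkcond big_ord_recr/= -big_mkcond/=; have [dn|dn] := boolP (1 < d * 2 ^+ n).
  move: (dn); rewrite key => dn'; rewrite (max_idPl _) in IH; last exact: ltW.
  rewrite (max_idPl _); last by apply: le_trans cn (ltW _).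
  apply: le_trans (lerD IH (lexx _)) _; rewrite exprS.
  rewrite -[X in _ + X](@mulfK _ (1 - c)) ?subr_eq0 ?gt_eqF// -mulrDl.
  rewrite ler_pM2r ?invr_gt0 ?subr_gt0//; lra.
move: dn; rewrite key -leNgt => dn; rewrite addr0.
rewrite (max_idPr _) in IH; last exact: dn.
apply: le_trans IH _; rewrite subrr mul0r divr_ge0 ?subr_ge0 ?(ltW c1)//.
by rewrite le_max lexx orbT.
Qed.

(** The first bound is the better one for [2 ^ k <= 1 / d], the second beyond;
for [0 < e < 1] both parts of the sum are dominated by the scale where they
agree. *)
Lemma sum_dyadic_min e d n (g : nat -> R) : 0 < e -> e < 1 -> 0 < d ->
  (forall k, (k < n)%N -> g k <= d^-1) -> (forall k, (k < n)%N -> g k <= (2 ^+ k)^-1 / d ^+ 2) ->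
  \sum_(k < n) (2 `^ e) ^+ k * g k <=
  (2 `^ e / (2 `^ e - 1) + (1 - 2 `^ (- (1 - e)))^-1) * d `^ (- (1 + e)).
Proof.
move=> e0 e1 d0 g1 g2; rewrite (bigID (fun k : 'I_n => d * 2 ^+ k <= 1))/= mulrDl.
have a0 : 0 <= 2 `^ e :> R by exact: powR_ge0.
apply: lerD.
  apply: (@le_trans _ _ (\sum_(k < n | d * 2 ^+ k <= 1) (2 `^ e) ^+ k * d^-1)).
    by apply: ler_sum => k _; rewrite ler_wpM2l ?exprn_ge0 ?g1.
  have -> : d `^ (- (1 + e)) = d `^ (- e) / d.
    rewrite -[in _ / d](powR_inv1 (ltW d0)) -powRD ?(gt_eqF d0) ?implybT//.
    by congr (_ `^ _); ring.
  rewrite -mulr_suml mulrA ler_pM2r ?invr_gt0//.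
  exact: sum_dyadic_low.
apply: (@le_trans _ _ (\sum_(k < n | 1 < d * 2 ^+ k) (2 `^ (- (1 - e))) ^+ k * (d ^+ 2)^-1)).
  under eq_bigl do rewrite -ltNge.
  apply: ler_sum => k _; apply: le_trans (ler_wpM2l _ (g2 _ (ltn_ord k))) _.
    by rewrite exprn_ge0.
  rewrite mulrA ler_pM2r ?invr_gt0 ?exprn_gt0// opprB powRD ?(pnatr_eq0 _ 2) ?implybT//.
  by rewrite powR_inv1// exprMn exprVn.
rewrite -mulr_suml [leRHS]mulrC.
have -> : d `^ (- (1 + e)) = d `^ (1 - e) / d ^+ 2.
  rewrite -powR_mulrn ?(ltW d0)// -powRN -powRD ?(gt_eqF d0) ?implybT//.
  by congr (_ `^ _); ring.
rewrite mulrAC ler_pM2r ?invr_gt0 ?exprn_gt0//.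
by apply: sum_dyadic_high; rewrite ?subr_gt0.
Qed.
End Dyadic.

(** * The discrete incidence estimate *)

Lemma young_weighted (R : realFieldType) (l w s x y : R) : 0 < l -> 0 < w ->
  2 * (s * (x * y)) <= l * (w * x ^+ 2) + l^-1 * (s ^+ 2 / w * y ^+ 2).
Proof.
move=> l0 w0; rewrite -subr_ge0.
have -> : l * (w * x ^+ 2) + l^-1 * (s ^+ 2 / w * y ^+ 2) - 2 * (s * (x * y)) =
  (l * w * x - s * y) ^+ 2 / (l * w) by field; rewrite !gt_eqF.
by rewrite divr_ge0 ?sqr_ge0// ltW// mulr_gt0.
Qed.

(** Cauchy-Schwarz, recovered by optimising over the parameter of Young's
inequality, which is linear in [A] and [B] and so can be summed over scales and
translations. *)
Lemma sqr_le_of_young (R : realFieldType) (x A B : R) : 0 <= x -> 0 <= A -> 0 <= B ->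
  (forall l, 0 < l -> 2 * x <= l * A + l^-1 * B) -> x ^+ 2 <= A * B.
Proof.
move=> x0 A0 B0 H; have [->|xn0] := eqVneq x 0; first by rewrite expr0n mulr_ge0.
have xp : 0 < x by rewrite lt_def xn0.
have [AE|An0] := eqVneq A 0.
  have B1 : 0 < B + 1 by lra.
  have /H : 0 < (B + 1) / x by rewrite divr_gt0.
  rewrite AE mulr0 add0r invf_div mulrAC ler_pdivlMr// => ?.
  by exfalso; nra.
have Ap : 0 < A by rewrite lt_def An0.
have /H : 0 < x / A by rewrite divr_gt0.
rewrite divfK ?gt_eqF// invf_div => H1.
have : x <= A / x * B by lra.
by rewrite mulrAC ler_pdivlMr// expr2.
Qed.

Lemma sum_sqr_expand (R : comPzRingType) (T : Type) (s : seq T) (I : finType)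
    (m : I -> R) (g : I -> T -> int) :
  \sum_(u <- s) (\sum_i m i * (g i u)%:~R) ^+ 2 =
  \sum_i \sum_i' m i * m i' * (\sum_(u <- s) g i u * g i' u)%:~R.
Proof.
transitivity (\sum_(u <- s) \sum_i \sum_i' m i * m i' * (g i u * g i' u)%:~R).
  apply: eq_bigr => u _; rewrite expr2 mulr_suml; apply: eq_bigr => i _.
  by rewrite mulr_sumr; apply: eq_bigr => i' _; rewrite rmorphM/= mulrACA.
rewrite exchange_big; apply: eq_bigr => i _; rewrite exchange_big; apply: eq_bigr => i' _.
by rewrite rmorph_sum mulr_sumr.
Qed.

(** The distance of two cells of the lattice, with first coordinates in units of
[P ^ -2] and second coordinates in units of [P ^ -4], cut off below at
[1 / P]. *)
Definition cell_dist (R : realType) (N : nat) (x y x' y' : int) : R :=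
  let P : int := 2 ^+ N in (gap (P ^+ 2) (P ^+ 3) x y x' y')%:~R / P%:~R ^+ 4.

Definition discrete_const (R : realType) (t : R) : R :=
  (40 * (90 * kernel_const))%:~R *
  (2 + 4 * (2 `^ (2 - t) / (2 `^ (2 - t) - 1) + (1 - 2 `^ (- (1 - (2 - t))))^-1)) *
  (2 `^ t / (2 `^ t - 1)).

Section Discrete.
Variables (R : realType) (N : nat).
Let P : int := 2 ^+ N.
Let Q : int := P ^+ 2.
Let L : int := P ^+ 3.
Let K : nat := absz (20 * Q ^+ 2).
Let H (k : nat) : int := 2 ^+ (N - k).

Let P_ge1 : 1 <= P. Proof. exact: exprn_ege1. Qed.

Let P_gt0 : 0 < P. Proof. exact: lt_le_trans P_ge1. Qed.

Let Q_ge1 : 1 <= Q. Proof. exact: exprn_ege1. Qed.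

Let QL : Q <= L. Proof. by rewrite /Q /L ler_weXn2l. Qed.

Let LQ : L <= Q ^+ 2. Proof. by rewrite /Q /L -exprM ler_weXn2l. Qed.

Let KE : K%:Z = 20 * Q ^+ 2.
Proof. by rewrite /K gez0_abs// mulr_ge0// exprn_ge0// (le_trans _ Q_ge1). Qed.

Let KQ : 20 * Q ^+ 2 <= K%:Z. Proof. by rewrite KE. Qed.

Let QQ : Q <= Q ^+ 2. Proof. by rewrite expr2 ler_peMl// (le_trans _ Q_ge1). Qed.

Let H_gt0 k : 0 < H k. Proof. exact: exprn_gt0. Qed.

Let H_leP k : H k <= P. Proof. by rewrite /H /P ler_weXn2l// leq_subr. Qed.

Let H_double k : (k < N)%N -> H k = 2 * H k.+1.
Proof. by move=> kN; rewrite /H -exprS -subSn. Qed.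

Let HPQ k : H k * P <= Q.
Proof. by rewrite /Q expr2 ler_wpM2r// ltW. Qed.

Let HP3Q k : H k * P ^+ 3 <= Q ^+ 2.
Proof. by rewrite /Q -exprM [leRHS]exprS ler_wpM2r// exprn_ge0// ltW. Qed.

Variables (I J : finType) (m : I -> R) (n : J -> R).
Variables (X Y : I -> int) (A B : J -> int).
Hypotheses (m_ge0 : forall i, 0 <= m i) (n_ge0 : forall j, 0 <= n j).
Hypotheses (XQ : forall i, `|X i| <= Q) (YQ : forall i, `|Y i| <= Q ^+ 2).
Hypotheses (AQ : forall j, `|A j| <= Q) (BQ : forall j, `|B j| <= 2 * Q ^+ 2).

Let bump i := line_bump Q L (X i) (Y i).
Let box k j (u : int * int) := box_ind (H k * P) (H k * P ^+ 3) ((A j, B j) - u).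
Let V k := corners (H k.+1 * P) (H k.+1 * P ^+ 3).

(** [F] is the superposition of the dual strips of the points, and [W k] that of
the boxes of scale [2 ^ -k] attached to the lines. *)
Let F u : R := \sum_i m i * (bump i u)%:~R.
Let W k u : R := \sum_j n j * (box k j u)%:~R.

Let box_neq0 k j u : box k j u != 0 -> `|u.1| <= 2 * Q /\ `|u.2| <= 3 * Q ^+ 2.
Proof.
move=> /box_ind_neq0/=; have := AQ j; have := BQ j; have := HPQ k; have := HP3Q k.
move: (H k * P) (H k * P ^+ 3) => a b.
by move: (Q ^+ 2) (u.1) (u.2) => q u1 u2; rewrite /GRing.add/= ; clear; lia.
Qed.

Let W_neq0 k u : W k u != 0 -> `|u.1| <= 2 * Q /\ `|u.2| <= 3 * Q ^+ 2.
Proof.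
move=> Wu; have [/existsP[j ju]|/existsPn H0] := boolP [exists j, box k j u != 0].
  exact: box_neq0 ju.
case/eqP: Wu; rewrite /W big1// => j _; move: (H0 j); rewrite negbK => /eqP ->.
by rewrite mulr0.
Qed.

Let box_split k j u : (k < N)%N -> box k j u = \sum_(v <- V k) box k.+1 j (u + v).
Proof.
move=> kN; rewrite /box H_double// -!mulrA box_ind_double ?mulr_ge0 ?exprn_ge0 ?(ltW (H_gt0 _)) ?(ltW P_gt0)//.
by apply: eq_bigr => v _; rewrite opprD addrA.
Qed.

Let W_split k u : (k < N)%N -> W k u = \sum_(v <- V k) W k.+1 (u + v).
Proof.
move=> kN; rewrite /W exchange_big; apply: eq_bigr => j _.
by rewrite box_split// rmorph_sum mulr_sumr.
Qed.

Let V_le k v : v \in V k -> `|v.1| <= H k.+1 * P /\ `|v.2| <= H k.+1 * P ^+ 3.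
Proof.
have h0 := ltW (H_gt0 k.+1); have p0 := ltW P_gt0.
have a0 : 0 <= H k.+1 * P by exact: mulr_ge0.
have b0 : 0 <= H k.+1 * P ^+ 3 by rewrite mulr_ge0// exprn_ge0.
by rewrite !inE => /or4P[] /eqP -> /=; rewrite ?normr0 ?ger0_norm.
Qed.

(** The translation of the smaller boxes is moved onto [F]. *)
Let pairing_split k : (k < N)%N ->
  \sum_(u <- zbox K) F u * W k u =
  \sum_(v <- V k) \sum_(u <- zbox K) F (u - v) * W k.+1 u.
Proof.
move=> kN; rewrite exchange_big/=.
under eq_bigr do rewrite W_split// mulr_sumr.
rewrite exchange_big [RHS]exchange_big/=; apply: eq_big_seq => v /V_le[v1 v2].
pose g u := F (u - v) * W k.+1 u.
transitivity (\sum_(u <- zbox K) g (u + v)).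
  by apply: eq_bigr => u _; rewrite /g addrK.
apply: sum_shift; first exact: zbox_uniq.
  move=> u; rewrite mulf_eq0 negb_or => /andP[_ /W_neq0[u1 u2]].
  rewrite mem_zbox KE; move: QQ u1 u2 Q_ge1; move: (Q ^+ 2) `|u.1| `|u.2| => q x y.
  by clear; move=> *; apply/andP; split; lia.
move=> u; rewrite mulf_eq0 negb_or => /andP[_ /W_neq0[]].
rewrite mem_zbox KE.
have := le_trans v1 (HPQ _); have := le_trans v2 (HP3Q _).
have -> : (u - v).1 = u.1 - v.1 by []; have -> : (u - v).2 = u.2 - v.2 by [].
move: QQ Q_ge1.
move: (Q ^+ 2) u.1 u.2 v.1 v.2 => q a b c d; clear=> *.
by apply/andP; split; lia.
Qed.

Let sum_V k (x : R) : \sum_(v <- V k) x = 4 * x.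
Proof. by rewrite big_const_seq count_predT iter_addr addr0/= mulr_natl. Qed.

Let pairing_step k : (k < N)%N ->
  4 ^+ k.+1 * (\sum_(u <- zbox K) F u * W k.+1 u) - 4 ^+ k * (\sum_(u <- zbox K) F u * W k u) =
  \sum_(v <- V k) \sum_(u <- zbox K) 4 ^+ k * ((F u - F (u - v)) * W k.+1 u).
Proof.
move=> kN; rewrite (pairing_split kN) exprSr -mulrA -mulrBr.
under [in RHS]eq_bigr do rewrite -mulr_sumr.
rewrite -mulr_sumr; congr (_ * _).
under [in RHS]eq_bigr do (under eq_bigr do rewrite mulrBl; rewrite sumrB).
rewrite sumrB; congr (_ - _).
by rewrite sum_V.
Qed.

Let pairing_telescope :
  4 ^+ N * (\sum_(u <- zbox K) F u * W N u) =
  \sum_(u <- zbox K) F u * W 0 u +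
  \sum_(k < N) \sum_(v <- V k) \sum_(u <- zbox K) 4 ^+ k * ((F u - F (u - v)) * W k.+1 u).
Proof.
pose a k := 4 ^+ k * (\sum_(u <- zbox K) F u * W k u).
have -> : 4 ^+ N * (\sum_(u <- zbox K) F u * W N u) = a 0 + \sum_(0 <= k < N) (a k.+1 - a k).
  by rewrite telescope_sumr// addrC subrK.
rewrite {1}/a expr0 mul1r big_mkord; congr (_ + _).
by apply: eq_bigr => k _; rewrite -pairing_step.
Qed.

Let energyF (c : R) : R := \sum_(u <- zbox K) F u ^+ 2 +
  \sum_(k < N) \sum_(v <- V k) c ^+ k * (\sum_(u <- zbox K) (F u - F (u - v)) ^+ 2).

Let energyW (c : R) : R := \sum_(u <- zbox K) W 0 u ^+ 2 +
  \sum_(k < N) \sum_(v <- V k) (16 / c) ^+ k * (\sum_(u <- zbox K) W k.+1 u ^+ 2).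

(** The weights [c ^ k] are those of a Sobolev norm; below [c = 2 ^ (2 - t)]. *)
Let pairing_young c l : 0 < c -> 0 < l ->
  2 * (4 ^+ N * (\sum_(u <- zbox K) F u * W N u)) <= l * energyF c + l^-1 * energyW c.
Proof.
move=> c0 l0; rewrite pairing_telescope /energyF /energyW !mulrDr addrACA; apply: lerD.
  rewrite !mulr_sumr -big_split/=; apply: ler_sum => u _.
  have := @young_weighted R l 1 1 (F u) (W 0 u) l0 ltr01.
  by rewrite !mul1r expr1n divr1 !mul1r.
rewrite !mulr_sumr -big_split/=; apply: ler_sum => k _.
rewrite !mulr_sumr -big_split/=; apply: ler_sum => v _.
rewrite !mulr_sumr -big_split/=; apply: ler_sum => u _.
have ck : 0 < c ^+ k by exact: exprn_gt0.
have := @young_weighted R l (c ^+ k) (4 ^+ k) (F u - F (u - v)) (W k.+1 u) l0 ck.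
have -> : (16 / c) ^+ k = (4 ^+ k) ^+ 2 / c ^+ k; last by [].
by rewrite expr_div_n -exprM mulnC exprM; congr ((_ ^+ _) / _); ring.
Qed.

Let incident i j := `|Y i - A j * X i - B j| <= 7 * L.

(** Moving a line within a box of sides [P] and [P ^ 3] changes
[Y - A * X - B] by at most [P * Q + P ^ 3 = 2 * L], which leads from the strip
of width [7 * L] to that of width [9 * L]. *)
Let bump_ge i j u : incident i j -> box N j u != 0 -> Q <= bump i u.
Proof.
move=> ij /box_ind_neq0; rewrite /H subnn expr0 !mul1r /bump /line_bump.
have -> : ((A j, B j) - u).1 = A j - u.1 by [].
have -> : ((A j, B j) - u).2 = B j - u.2 by [].
move=> /and4P[a0 aP b0 bL].
have PQ : P <= Q by rewrite /Q expr2 ler_peMr// ltW.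
have uQ : `|u.1| <= 2 * Q.
  by move: (AQ j) PQ a0 aP; clear; move: u.1 (A j) => *; lia.
have -> : strip (9 * L) (Y i - u.1 * X i - u.2) = 1; last first.
  rewrite mulr1; apply: tent_ge => //.
rewrite /strip ifT//.
have aX : `|(A j - u.1) * X i| <= P * Q.
  rewrite normrM; apply: ler_pM => //; by move: a0 aP; clear; move: (A j - u.1) => *; lia.
have PQE : P * Q = L by rewrite /Q /L -exprS.
have -> : Y i - u.1 * X i - u.2 = (Y i - A j * X i - B j) + (A j - u.1) * X i + (B j - u.2) by ring.
move: aX ij b0 bL; rewrite PQE /incident.
move: ((A j - u.1) * X i) (Y i - A j * X i - B j) (B j - u.2) => a b c; rewrite -/L; clear.
move: L => l *; lia.
Qed.

Lemma sum_box k j : \sum_(u <- zbox K) box k j u = H k ^+ 2 * P ^+ 4.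
Proof.
rewrite /box sum_box_ind ?mulr_ge0 ?exprn_ge0 ?(ltW (H_gt0 _)) ?(ltW P_gt0)//.
- ring.
- rewrite KE; have := AQ j; have := HPQ k; move: (H k * P) => h; have := QQ.
  by move: (Q ^+ 2) (A j) Q_ge1 => q a; clear; move: Q => *; lia.
- rewrite KE; have := BQ j; have := HP3Q k; move: (H k * P ^+ 3) => h; have := QQ.
  by move: (Q ^+ 2) (B j) Q_ge1 => q a; clear; move: Q => *; lia.
Qed.

Let pairing_ge : P%:~R ^+ 8 * (\sum_i \sum_j m i * n j * (incident i j)%:R) <=
  4 ^+ N * (\sum_(u <- zbox K) F u * W N u).
Proof.
have -> : \sum_(u <- zbox K) F u * W N u =
    \sum_i \sum_j m i * n j * (\sum_(u <- zbox K) bump i u * box N j u)%:~R.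
  transitivity (\sum_(u <- zbox K) \sum_i \sum_j m i * n j * (bump i u * box N j u)%:~R).
    apply: eq_bigr => u _; rewrite /F /W mulr_suml; apply: eq_bigr => i _.
    by rewrite mulr_sumr; apply: eq_bigr => j _; rewrite mulrACA [in RHS]rmorphM.
  rewrite exchange_big; apply: eq_bigr => i _; rewrite exchange_big; apply: eq_bigr => j _.
  by rewrite rmorph_sum mulr_sumr.
rewrite !mulr_sumr; apply: ler_sum => i _; rewrite !mulr_sumr; apply: ler_sum => j _.
rewrite mulrCA [leRHS]mulrCA; apply: ler_wpM2l; first exact: mulr_ge0.
have b0 u : 0 <= bump i u by apply: mulr_ge0; [exact: tent_ge0|exact: strip_ge0].
have S0 : 0 <= \sum_(u <- zbox K) bump i u * box N j u.
  by apply: sumr_ge0 => u _; apply: mulr_ge0 => //; exact: box_ind_ge0.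
have [ij|_] := boolP (incident i j); last first.
  by rewrite mulr0n mulr0; apply: mulr_ge0; rewrite ?exprn_ge0 ?ler0z.
rewrite mulr1n mulr1; have -> : P%:~R ^+ 8 = 4 ^+ N * (Q * P ^+ 4)%:~R :> R.
  have -> : 4 ^+ N = (P ^+ 2)%:~R :> R.
    by rewrite /P -exprM mulnC exprM rmorphXn; congr (_ ^+ _).
  by rewrite -rmorphM -rmorphXn/=; congr (_%:~R); rewrite /Q; ring.
apply: ler_wpM2l; first exact: exprn_ge0.
rewrite ler_int; have -> : P ^+ 4 = \sum_(u <- zbox K) box N j u.
  by rewrite sum_box /H subnn expr0 expr1n mul1r.
rewrite mulr_sumr; apply: ler_sum => u _.
have [->|bu] := eqVneq (box N j u) 0; first by rewrite !mulr0.
apply: ler_wpM2r; [exact: box_ind_ge0|exact: bump_ge ij bu].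
Qed.

Let kap : R := (40 * (90 * kernel_const))%:~R.
Let p : R := P%:~R.
Let dist := @cell_dist R N.
Let distE x y x' y' : dist x y x' y' = (gap Q L x y x' y')%:~R / p ^+ 4. Proof. by []. Qed.

Let p_gt0 : 0 < p. Proof. by rewrite ltr0z. Qed.

Let kap_ge0 : 0 <= kap.
Proof. by rewrite ler0z; have := kernel_const_ge0; clear; lia. Qed.

Let pE : p = 2 ^+ N. Proof. by rewrite /p /P rmorphXn. Qed.

Let castM (a b : int) : (a * b)%:~R = a%:~R * b%:~R :> R. Proof. exact: rmorphM. Qed.

Let castX (a : int) k : (a ^+ k)%:~R = a%:~R ^+ k :> R. Proof. exact: rmorphXn. Qed.

Let gap_gt0 x y x' y' : 0 < gap Q L x y x' y'.
Proof. by rewrite /gap lt_max (lt_le_trans _ QL) ?orbT//; exact: lt_le_trans Q_ge1. Qed.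

Let dist_gt0 x y x' y' : 0 < dist x y x' y'.
Proof. by rewrite distE divr_gt0 ?ltr0z// exprn_gt0. Qed.

Let selfF_le i i' :
  (\sum_(u <- zbox K) bump i u * bump i' u)%:~R <=
  kap * p ^+ 8 / dist (X i) (Y i) (X i') (Y i').
Proof.
have := line_bump_self Q_ge1 QL LQ KQ (XQ i) (YQ i) (XQ i') (YQ i').
rewrite -/(bump i) -/(bump i'); set S := \sum_(_ <- _) _; set r := gap _ _ _ _ _ _ => Sr.
rewrite distE -/r ler_pdivlMr ?divr_gt0 ?ltr0z ?gap_gt0 ?exprn_gt0//.
rewrite mulrA ler_pdivrMr ?exprn_gt0//.
have : (S * r)%:~R <= (40 * (90 * kernel_const) * P ^+ 12)%:~R :> R.
  rewrite ler_int; apply: le_trans Sr _.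
  have -> : 45 * kernel_const * Q ^+ 3 * L ^+ 2 = 45 * kernel_const * P ^+ 12 by rewrite /Q /L; ring.
  apply: ler_wpM2r; first by rewrite exprn_ge0// ltW.
  by have := kernel_const_ge0; clear; lia.
by rewrite (castM S) (castM _ (P ^+ 12)) castX -/kap -/p -[kap * _ * _]mulrA -exprD.
Qed.

Let diff v i i' := \sum_(u <- zbox K) (bump i u - bump i (u - v)) * (bump i' u - bump i' (u - v)).

(** [line_bump_diff] in the original units. The translations [v] of level [k] are
at most [h = H k.+1 * P], that is, [2 ^ -(k + 1)] in units of slope. *)
Let diffF_le k v i i' : (k < N)%N -> v \in V k ->
  (diff v i i')%:~R <= kap * p ^+ 8 * (dist (X i) (Y i) (X i') (Y i'))^-1 /\
  (diff v i i')%:~R <= kap * p ^+ 8 * ((2 ^+ k)^-1 / dist (X i) (Y i) (X i') (Y i') ^+ 2).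
Proof.
move=> kN /V_le; case: v => v1 v2 /= [v1h v2h].
have h0 : 0 <= H k.+1 * P by rewrite mulr_ge0// ltW.
have LhQ : L <= H k.+1 * P * Q.
  have -> : H k.+1 * P * Q = H k.+1 * L by rewrite /Q /L; ring.
  by apply: ler_peMl; [rewrite exprn_ge0// ltW|exact: exprn_ege1].
have QhL : Q ^+ 2 <= H k.+1 * P * L.
  have -> : H k.+1 * P * L = H k.+1 * Q ^+ 2 by rewrite /Q /L; ring.
  by apply: ler_peMl; [rewrite exprn_ge0// (le_trans _ Q_ge1)|exact: exprn_ege1].
have v2h' : `|v2| <= H k.+1 * P * Q.
  by have -> : H k.+1 * P * Q = H k.+1 * P ^+ 3 by rewrite /Q; ring.
have [] := line_bump_diff Q_ge1 QL LQ KQ h0 (HPQ _) LhQ QhL (XQ i) (YQ i) (XQ i') (YQ i') v1h v2h'.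
rewrite -/(bump i) -/(bump i') -/(diff (v1, v2) i i').
move: (diff _ _ _) => S; rewrite !distE; have := gap_gt0 (X i) (Y i) (X i') (Y i').
move: (gap _ _ _ _ _ _) => r r0 S1 S2.
have R0 : 0 < r%:~R :> R by rewrite ltr0z.
have P4 : 0 < p ^+ 4 by exact: exprn_gt0.
split.
  rewrite ler_pdivlMr ?divr_gt0// mulrA ler_pdivrMr//.
  have : (S * r)%:~R <= (40 * (90 * kernel_const) * P ^+ 12)%:~R :> R.
    rewrite ler_int; apply: le_trans S1 _.
    have -> : 90 * kernel_const * Q ^+ 3 * L ^+ 2 = 90 * kernel_const * P ^+ 12 by rewrite /Q /L; ring.
    apply: ler_wpM2r; first by rewrite exprn_ge0// ltW.
    by have := kernel_const_ge0; clear; lia.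
  by rewrite (castM S) (castM _ (P ^+ 12)) castX -/kap -/p -[kap * _ * _]mulrA -exprD.
rewrite mulrA ler_pdivlMr ?exprn_gt0 ?divr_gt0// expr_div_n mulrA ler_pdivrMr ?exprn_gt0//.
have : (S * r ^+ 2)%:~R <= (40 * (90 * kernel_const) * (H k.+1 * P ^+ 15))%:~R :> R.
  rewrite ler_int; apply: le_trans S2 _.
  rewrite [leLHS](_ : _ = 40 * (90 * kernel_const) * (H k.+1 * P ^+ 15))//.
  by rewrite /Q /L; move: (90 * kernel_const) => b; ring.
rewrite (castM S) (castM _ (_ * _)) (castM (H _)) (castX r) (castX P) -/kap -/p => /le_trans; apply.
rewrite -(mulrA kap (p ^+ 8)) -(mulrA kap); apply: ler_wpM2l => //.
have HE : (H k.+1)%:~R = p / 2 ^+ k.+1 :> R.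
  have -> : p = 2 ^+ (N - k.+1) * 2 ^+ k.+1 by rewrite pE -exprD subnK.
  by rewrite /H castX mulfK// expf_neq0// pnatr_eq0.
rewrite HE.
have -> : p / 2 ^+ k.+1 * p ^+ 15 = (2^-1) * (p ^+ 8 * (2 ^+ k)^-1 * (p ^+ 4) ^+ 2).
  by rewrite exprS; field; rewrite expf_neq0// pnatr_eq0.
apply: ler_piMl; last by rewrite invf_le1 ?ler1n.
by rewrite !mulr_ge0 ?invr_ge0 ?exprn_ge0 ?(ltW p_gt0).
Qed.

Let dist_le2 i i' : dist (X i) (Y i) (X i') (Y i') <= 2.
Proof.
rewrite distE ler_pdivrMr ?exprn_gt0// -castX -[2]/((2 : int)%:~R) -castM ler_int.
have -> : P ^+ 4 = Q ^+ 2 by rewrite /Q -exprM.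
rewrite /gap !ge_max.
have Q0 := le_trans ler01 Q_ge1.
have ZQ : Q * `|X i - X i'| <= Q * (2 * Q).
  by rewrite ler_wpM2l//; have := XQ i; have := XQ i'; move: (X i) (X i') Q; clear; lia.
apply/andP; split; [apply/andP; split|].
- by apply: le_trans ZQ _; rewrite le_eqVlt; apply/orP; left; apply/eqP; ring.
- by have := YQ i; have := YQ i'; move: (Y i) (Y i') (Q ^+ 2); clear; lia.
- by apply: le_trans LQ _; move: (Q ^+ 2) (exprn_ge0 2 Q0); clear; lia.
Qed.

Let energyF_expand c : energyF c = \sum_i \sum_i' m i * m i' *
  ((\sum_(u <- zbox K) bump i u * bump i' u)%:~R +
   \sum_(k < N) \sum_(v <- V k) c ^+ k * (diff v i i')%:~R).
Proof.
under eq_bigr do under eq_bigr do rewrite mulrDr.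
under eq_bigr do rewrite big_split/=.
rewrite big_split/= /energyF; congr (_ + _); first exact: sum_sqr_expand.
transitivity (\sum_(k < N) \sum_(v <- V k) \sum_i \sum_i' m i * m i' * (c ^+ k * (diff v i i')%:~R)).
  apply: eq_bigr => k _; apply: eq_bigr => v _.
  have -> : \sum_(u <- zbox K) (F u - F (u - v)) ^+ 2 =
      \sum_(u <- zbox K) (\sum_i m i * (bump i u - bump i (u - v))%:~R) ^+ 2.
    apply: eq_bigr => u _; congr (_ ^+ 2); rewrite /F -sumrB.
    by apply: eq_bigr => i _; rewrite -mulrBr -rmorphB.
  rewrite (sum_sqr_expand _ m (fun i u => bump i u - bump i (u - v))) mulr_sumr.
  apply: eq_bigr => i _; rewrite mulr_sumr; apply: eq_bigr => i' _.
  by rewrite mulrCA.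
under [LHS]eq_bigr do rewrite exchange_big/=.
rewrite exchange_big/=; apply: eq_bigr => i _.
under [LHS]eq_bigr do rewrite exchange_big/=.
rewrite exchange_big/=; apply: eq_bigr => i' _.
rewrite mulr_sumr; apply: eq_bigr => k _.
by rewrite mulr_sumr.
Qed.

Variable t : R.
Hypotheses (t1 : 1 < t) (t2 : t < 2).
Let e := 2 - t.
Let e_gt0 : 0 < e. Proof. by rewrite subr_gt0. Qed.

Let e_lt1 : e < 1. Proof. by rewrite /e ltrBlDr -[2]/(1 + 1) ltrD2l. Qed.

Let constF : R := kap * (2 + 4 * (2 `^ e / (2 `^ e - 1) + (1 - 2 `^ (- (1 - e)))^-1)).

(** The weighted sum over the scales of the smaller of [1 / d] and
[2 ^ -k / d ^ 2]. *)
Let energyF_le : energyF (2 `^ e) <= constF * p ^+ 8 *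
  \sum_i \sum_i' m i * m i' * dist (X i) (Y i) (X i') (Y i') `^ (- (3 - t)).
Proof.
rewrite energyF_expand mulr_sumr; apply: ler_sum => i _.
rewrite mulr_sumr; apply: ler_sum => i' _.
rewrite [leRHS]mulrCA; apply: ler_wpM2l; first exact: mulr_ge0.
have := dist_le2 i i'; have := dist_gt0 (X i) (Y i) (X i') (Y i').
have := selfF_le i i'; have := fun k v => @diffF_le k v i i'.
move: (dist _ _ _ _) => d df sf d0 d2.
have kp0 : 0 <= kap * p ^+ 8 by rewrite mulr_ge0// exprn_ge0// ltW.
have tE : - (3 - t) = - (1 + e) by rewrite /e; ring.
rewrite tE; set d1 := d `^ (- (1 + e)).
have d10 : 0 <= d1 by exact: powR_ge0.
have self_le : d^-1 <= 2 * d1.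
  have -> : d1 = d `^ (- e) / d.
    rewrite /d1 -[in RHS](powR_inv1 (ltW d0)) -powRD ?(gt_eqF d0) ?implybT//.
    by congr (_ `^ _); ring.
  rewrite mulrA ler_peMl ?invr_ge0 ?(ltW d0)// powRN ler_pdivlMr ?powR_gt0// mul1r.
  apply: (@le_trans _ _ (2 `^ e)).
    by apply: ge0_ler_powR; rewrite ?nnegrE ?(ltW e_gt0) ?(ltW d0).
  by apply: ler1_powR; [rewrite ler1n|exact: ltW].
have diff_le : \sum_(k < N) \sum_(v <- V k) (2 `^ e) ^+ k * (diff v i i')%:~R <=
    kap * p ^+ 8 * 4 * \sum_(k < N) (2 `^ e) ^+ k * Num.min d^-1 ((2 ^+ k)^-1 / d ^+ 2).
  rewrite mulr_sumr; apply: ler_sum => k _.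
  set M := Num.min _ _.
  apply: (@le_trans _ _ (\sum_(v <- V k) (2 `^ e) ^+ k * (kap * p ^+ 8 * M))).
    rewrite big_seq [leRHS]big_seq; apply: ler_sum => v vk.
    apply: ler_wpM2l; first by rewrite exprn_ge0// powR_ge0.
    by have [? ?] := df k v (ltn_ord k) vk; rewrite /M minEle; case: ifP.
  rewrite sum_V le_eqVlt; apply/orP; left; apply/eqP.
  by move: ((2 `^ e) ^+ k) => z; ring.
have min_le := @sum_dyadic_min R e d N (fun k => Num.min d^-1 ((2 ^+ k)^-1 / d ^+ 2)) e_gt0 e_lt1 d0 _ _.
apply: le_trans (lerD sf diff_le) _.
apply: (@le_trans _ _ (kap * p ^+ 8 * (2 * d1) + kap * p ^+ 8 * 4 *
  ((2 `^ e / (2 `^ e - 1) + (1 - 2 `^ (- (1 - e)))^-1) * d1))).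
  apply: lerD; first exact: ler_wpM2l.
  apply: ler_wpM2l; first by rewrite mulr_ge0.
  by apply: min_le => k _; rewrite ge_min lexx ?orbT.
rewrite /constF le_eqVlt; apply/orP; left; apply/eqP.
by move: (2 `^ e / (2 `^ e - 1) + (1 - 2 `^ (- (1 - e)))^-1) => z; ring.
Qed.

(** Two boxes of scale [2 ^ -k] only meet if the lines are closer than
[2 ^ -k]. *)
Let boxW_le k j j' : (k <= N)%N ->
  (\sum_(u <- zbox K) box k j u * box k j' u)%:~R <=
  p ^+ 6 / 4 ^+ k * (dist (A j) (B j) (A j') (B j') * 2 ^+ k <= 1)%R%:R :> R.
Proof.
move=> kN.
have HE : (H k)%:~R = p / 2 ^+ k :> R.
  have -> : p = 2 ^+ (N - k) * 2 ^+ k by rewrite pE -exprD subnK.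
  by rewrite /H castX mulfK// expf_neq0// pnatr_eq0.
have cE : p ^+ 6 / 4 ^+ k = (H k ^+ 2 * P ^+ 4)%:~R :> R.
  rewrite castM (castX (H k)) (castX P) HE -/p -[4](_ : 2 * 2 = 4 :> R); last by rewrite -natrM.
  by rewrite exprMn; field; rewrite expf_neq0// pnatr_eq0.
have [D|D] := boolP (_ <= 1).
  rewrite mulr1 cE ler_int -(sum_box k j); apply: ler_sum => u _.
  by rewrite -[leRHS]mulr1 ler_wpM2l ?box_ind_ge0 ?box_ind_le1.
rewrite mulr0 big1_seq// => u /= _.
have [->|bj] := eqVneq (box k j u) 0; first by rewrite mul0r.
have [->|bj'] := eqVneq (box k j' u) 0; first by rewrite mulr0.
exfalso; move/negP: D; apply.
have gapH : gap Q L (A j) (B j) (A j') (B j') <= H k * P ^+ 3.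
  move: (box_ind_neq0 bj) (box_ind_neq0 bj').
  have -> : ((A j, B j) - u).1 = A j - u.1 by [].
  have -> : ((A j, B j) - u).2 = B j - u.2 by [].
  have -> : ((A j', B j') - u).1 = A j' - u.1 by [].
  have -> : ((A j', B j') - u).2 = B j' - u.2 by [].
  have Q0 := le_trans ler01 Q_ge1.
  move=> /and4P[a1 a2 b1 b2] /and4P[a1' a2' b1' b2'].
  have aa : `|A j - A j'| <= H k * P.
    by move: a1 a2 a1' a2'; move: (A j) (A j') u.1 (H k * P); clear; lia.
  rewrite /gap !ge_max; apply/andP; split; [apply/andP; split|].
  - apply: le_trans (ler_wpM2l Q0 aa) _.
    by rewrite le_eqVlt; apply/orP; left; apply/eqP; rewrite /Q; ring.
  - by move: b1 b2 b1' b2'; move: (B j) (B j') u.2 (H k * P ^+ 3); clear; lia.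
  - by rewrite ler_peMl ?exprn_ege1// exprn_ge0// ltW.
rewrite distE mulrAC ler_pdivrMr ?exprn_gt0// mul1r.
have : (gap Q L (A j) (B j) (A j') (B j'))%:~R <= (H k * P ^+ 3)%:~R :> R by rewrite ler_int.
by rewrite castM (castX P) HE -/p mulrAC ler_pdivlMr ?exprn_gt0.
Qed.

Let energyW_expand c : energyW c = \sum_j \sum_j' n j * n j' *
  ((\sum_(u <- zbox K) box 0 j u * box 0 j' u)%:~R +
   \sum_(k < N) 4 * (16 / c) ^+ k * (\sum_(u <- zbox K) box k.+1 j u * box k.+1 j' u)%:~R).
Proof.
under eq_bigr do under eq_bigr do rewrite mulrDr.
under eq_bigr do rewrite big_split/=.
rewrite big_split/= /energyW; congr (_ + _); first exact: sum_sqr_expand.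
transitivity (\sum_(k < N) \sum_j \sum_j' n j * n j' *
    (4 * (16 / c) ^+ k * (\sum_(u <- zbox K) box k.+1 j u * box k.+1 j' u)%:~R)).
  apply: eq_bigr => k _; rewrite sum_V.
  rewrite (sum_sqr_expand _ n (box k.+1)).
  under [RHS]eq_bigr do under eq_bigr do rewrite mulrCA.
  under [RHS]eq_bigr do rewrite -mulr_sumr.
  by rewrite -mulr_sumr mulrA.
rewrite exchange_big/=; apply: eq_bigr => j _.
rewrite exchange_big/=; apply: eq_bigr => j' _.
by rewrite mulr_sumr.
Qed.

Let constW : R := 2 `^ t / (2 `^ t - 1).

Let energyW_le : energyW (2 `^ e) <= constW * p ^+ 6 *
  \sum_j \sum_j' n j * n j' * dist (A j) (B j) (A j') (B j') `^ (- t).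
Proof.
rewrite energyW_expand mulr_sumr; apply: ler_sum => j _.
rewrite mulr_sumr; apply: ler_sum => j' _.
rewrite [leRHS]mulrCA; apply: ler_wpM2l; first exact: mulr_ge0.
have := dist_gt0 (A j) (B j) (A j') (B j'); have := fun k => @boxW_le k j j'.
move: (dist _ _ _ _) => d bw d0.
have t0 : 0 < t by apply: lt_trans t1.
have low := @sum_dyadic_low R t d N.+1 t0 d0.
apply: (@le_trans _ _ (p ^+ 6 * \sum_(k < N.+1 | d * 2 ^+ k <= 1) (2 `^ t) ^+ k)); last first.
  by rewrite [leRHS]mulrAC mulrC -/constW; apply: ler_wpM2r => //; rewrite exprn_ge0// ltW.
rewrite [in leRHS]big_mkcond [in leRHS]big_ord_recl mulrDr; apply: lerD.
  apply: le_trans (bw _ (leq0n _)) _.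
  by rewrite !expr0 divr1 mulr1; case: ifP => _; rewrite ?mulr1 ?mulr0.
rewrite mulr_sumr; apply: ler_sum => k _.
have c0 : 0 < 2 `^ e :> R by exact: powR_gt0.
have ratio : 2 `^ t = 4 / 2 `^ e :> R.
  have -> : t = 2%:R - e by rewrite /e; ring.
  by rewrite powRB ?powR_mulrn ?pnatr_eq0 ?implybT//; congr (_ / _); rewrite -natrX.
apply: (@le_trans _ _ (4 * (16 / 2 `^ e) ^+ k * (p ^+ 6 / 4 ^+ k.+1 * (d * 2 ^+ k.+1 <= 1)%R%:R))).
  apply: ler_wpM2l; last exact: bw.
  by rewrite mulr_ge0// exprn_ge0// divr_ge0// ltW.
have -> : 4 * (16 / 2 `^ e) ^+ k * (p ^+ 6 / 4 ^+ k.+1 * (d * 2 ^+ k.+1 <= 1)%R%:R) =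
    p ^+ 6 * ((2 `^ t) ^+ k * (d * 2 ^+ k.+1 <= 1)%R%:R).
  rewrite ratio !expr_div_n (exprS 4) (_ : 16 = 4 * 4 :> R); last by rewrite -natrM.
  rewrite exprMn; have : 4 ^+ k != 0 :> R by rewrite expf_neq0// pnatr_eq0.
  have : (2 `^ e) ^+ k != 0 by rewrite expf_neq0// gt_eqF.
  by move: (4 ^+ k) ((2 `^ e) ^+ k) => x y x0 y0; field; rewrite x0.
apply: ler_wpM2l; first by rewrite exprn_ge0// ltW.
rewrite !lift0; case: ifP => _; rewrite ?mulr0// mulr1.
by rewrite exprS ler_peMl ?exprn_ge0 ?powR_ge0// ltW// powR_gt1.
Qed.

(** The energies of [F] and [W] carry the factors [p ^ 8] and [p ^ 6], and the
pairing the factor [p ^ 8]; the gain [p ^ 2] left after squaring is the factor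
[delta] of the incidence estimate. *)
Lemma discrete_incidence_le :
  (p * (\sum_i \sum_j m i * n j * (incident i j)%:R)) ^+ 2 <= discrete_const t *
  ((\sum_i \sum_i' m i * m i' * dist (X i) (Y i) (X i') (Y i') `^ (- (3 - t))) *
   (\sum_j \sum_j' n j * n j' * dist (A j) (B j) (A j') (B j') `^ (- t))).
Proof.
set S := \sum_i _; set E1 := \sum_i _; set E2 := \sum_j _.
have S0 : 0 <= S.
  by apply: sumr_ge0 => i _; apply: sumr_ge0 => j _; rewrite !mulr_ge0.
have c0 : 0 < 2 `^ e :> R by exact: powR_gt0.
have F0 : 0 <= energyF (2 `^ e).
  apply: addr_ge0; first by apply: sumr_ge0 => u _; exact: sqr_ge0.
  apply: sumr_ge0 => k _; apply: sumr_ge0 => v _; apply: mulr_ge0.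
    by rewrite exprn_ge0 ?ltW.
  by apply: sumr_ge0 => u _; exact: sqr_ge0.
have W0 : 0 <= energyW (2 `^ e).
  apply: addr_ge0; first by apply: sumr_ge0 => u _; exact: sqr_ge0.
  apply: sumr_ge0 => k _; apply: sumr_ge0 => v _; apply: mulr_ge0.
    by rewrite exprn_ge0 ?divr_ge0 ?ltW.
  by apply: sumr_ge0 => u _; exact: sqr_ge0.
have H1 : (p ^+ 8 * S) ^+ 2 <= energyF (2 `^ e) * energyW (2 `^ e).
  apply: sqr_le_of_young => //; first by rewrite mulr_ge0// exprn_ge0// ltW.
  move=> l l0; apply: le_trans (pairing_young c0 l0).
  by rewrite ler_pM2l//; exact: pairing_ge.
have FE : energyF (2 `^ e) <= constF * p ^+ 8 * E1 by exact: energyF_le.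
have WE : energyW (2 `^ e) <= constW * p ^+ 6 * E2 by exact: energyW_le.
have H2 := le_trans H1 (ler_pM F0 W0 FE WE).
have p14 : 0 < p ^+ 14 by exact: exprn_gt0.
rewrite -(ler_pM2l p14).
have -> : p ^+ 14 * (p * S) ^+ 2 = (p ^+ 8 * S) ^+ 2 by ring.
rewrite [discrete_const t](_ : _ = constF * constW)//.
apply: le_trans H2 _; rewrite le_eqVlt; apply/orP; left; apply/eqP.
by move: (constF) (constW) (E1) (E2) => a b c d; ring.
Qed.
End Discrete.

(** * From measures to masses of cells *)

Section Cells.
Context {d : measure_display} {T : measurableType d} {R : realType}.

Import HBNNSimple.
(** The integral of a nonnegative function is a supremum over the simple
functions below it, so it is monotone even without measurability. *)
Lemma ge0_integral_mono (mu : {measure set T -> \bar R}) (f g : T -> \bar R) :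
  (forall x, 0 <= f x)%E -> (forall x, f x <= g x)%E ->
  (\int[mu]_x f x <= \int[mu]_x g x)%E.
Proof.
move=> f0 fg; have g0 x : (0 <= g x)%E by exact: le_trans (f0 x) (fg x).
rewrite !ge0_integralTE//; apply: ereal_sup_le => _ /= [h hf <-].
by exists h => // x; exact: le_trans (hf x) (fg x).
Qed.

(** The left-hand side is the integral of a simple function lying below [f]. *)
Lemma sum_cells_le_integral (mu : {measure set T -> \bar R}) (I : finType) (S : I -> set T)
    (c : I -> R) (f : T -> \bar R) :
  (forall i, measurable (S i)) -> (forall i j x, S i x -> S j x -> i = j) ->
  (forall i, 0 <= c i) -> (forall x, 0 <= f x)%E ->
  (forall i x, S i x -> (c i)%:E <= f x)%E ->
  (\sum_i (c i)%:E * mu (S i) <= \int[mu]_x f x)%E.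
Proof.
move=> mS Sdisj c0 f0 cf.
pose g x : \bar R := (\sum_i (c i)%:E * (\1_(S i) x)%:E)%E.
have cS0 i x : (0 <= (c i)%:E * (\1_(S i) x)%:E :> \bar R)%E by rewrite mule_ge0// lee_fin.
have -> : (\sum_i (c i)%:E * mu (S i) = \int[mu]_x g x)%E.
  rewrite /g ge0_integral_sum//; last first.
    move=> i; apply: emeasurable_funM => //.
    by apply/measurable_EFinP; exact: measurable_indic.
  apply: eq_bigr => i _; rewrite ge0_integralZl_EFin//=.
    by rewrite integral_indic// setIT.
  by apply/measurable_EFinP; exact: measurable_indic.
apply: ge0_integral_mono => x; first by apply: sume_ge0.
have [[i Si]|nS] := pselect (exists i, S i x).
  rewrite /g (bigD1 i)//= big1 ?adde0; last first.
    move=> j ji; rewrite indicE memNset ?mule0// => Sj.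
    by move/eqP: ji; apply; exact: Sdisj Sj Si.
  by rewrite indicE mem_set// mule1; exact: cf.
rewrite /g big1// => i _; rewrite indicE memNset ?mule0// => Si.
by apply: nS; exists i.
Qed.
End Cells.

Lemma sum_cells_le_energy (R : realType) (s : R)
    (mu : {finite_measure set (R * R)%type -> \bar R}) (I : finType)
    (S : I -> set (R * R)) (k : I -> I -> R) :
  (forall i, measurable (S i)) -> (forall i j x, S i x -> S j x -> i = j) ->
  (forall i j, 0 <= k i j) ->
  (forall i j x y, S i x -> S j y -> (k i j)%:E <= riesz_kernel s x y)%E ->
  ((\sum_i \sum_j fine (mu (S i)) * fine (mu (S j)) * k i j)%:E <= riesz_energy s mu)%E.
Proof.
move=> mS Sdisj k0 kle.
have r0 x y : (0 <= riesz_kernel s x y)%E by rewrite /riesz_kernel inve_ge0 lee_fin powR_ge0.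
have inner j y : S j y -> ((\sum_i fine (mu (S i)) * k i j)%:E <= \int[mu]_x riesz_kernel s x y)%E.
  move=> Sj; have := @sum_cells_le_integral _ _ R mu I S (k ^~ j) (fun x => riesz_kernel s x y).
  move=> /(_ mS Sdisj (k0 ^~ j) (r0 ^~ y)) H; apply: le_trans (H _); last first.
    by move=> i x Si; exact: kle.
  rewrite -sumEFin; apply: lee_sum => i _.
  by rewrite -[X in (_ <= _ * X)%E]fineK ?fin_num_measure// -EFinM mulrC.
rewrite /riesz_energy; apply: le_trans (@sum_cells_le_integral _ _ R mu I S
  (fun j => \sum_i fine (mu (S i)) * k i j)
  (fun y => \int[mu]_x riesz_kernel s x y)%E mS Sdisj _ _ inner).
- rewrite exchange_big/= -sumEFin; apply: lee_sum => j _.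
  rewrite -[X in (_ <= _ * X)%E]fineK ?fin_num_measure// -EFinM lee_fin mulr_suml; apply: ler_sum => i _.
  by rewrite mulrAC.
- by move=> j; apply: sumr_ge0 => i _; rewrite mulr_ge0// fine_ge0.
- by move=> y; apply: integral_ge0 => x _.
Qed.

Lemma product_measure_le_cells (R : realType)
    (mu nu : {finite_measure set (R * R)%type -> \bar R}) (I J : finType)
    (S : I -> set (R * R)) (T : J -> set (R * R)) (E : set ((R * R) * (R * R)))
    (inc : I -> J -> bool) :
  (forall i, measurable (S i)) -> (forall j, measurable (T j)) -> measurable E ->
  (forall p q, E (p, q) -> exists i j, [/\ S i p, T j q & inc i j]) ->
  ((mu \x nu) E <= (\sum_i \sum_j fine (mu (S i)) * fine (nu (T j)) * (inc i j)%:R)%:E)%E.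
Proof.
move=> mS mT mE cover.
pose H (ij : I * J) := inc ij.1 ij.2.
have mST (ij : I * J) : [set` H] ij -> measurable (S ij.1 `*` T ij.2).
  by move=> _; exact: measurableX.
have sub : E `<=` \bigcup_(ij in [set` H]) (S ij.1 `*` T ij.2).
  by move=> [p q] /cover[i [j [Si Tj ij]]]; exists (i, j).
apply: le_trans (content_sub_fsum (mu \x nu)%E finite_finset mST mE sub) _.
rewrite -(@bigfs _ _ _ _ (index_enum (I * J)%type)) ?index_enum_uniq//; last first.
  by move=> ij _; rewrite mem_index_enum.
rewrite big_mkcond pair_big/= -sumEFin; apply: lee_sum => -[i j] _ /=.
rewrite /H/=; case: ifP => _; last by rewrite mulr0.
by rewrite mulr1 EFinM !fineK ?fin_num_measure//; rewrite product_measure1E.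
Qed.

(** * Trigonometric estimates on a quarter turn *)

Section Trigonometry.
Variable R : realType.
Implicit Types x y : R.

Lemma cos_lip x y : `|cos x - cos y| <= `|x - y|.
Proof.
wlog xy : x y / y <= x.
  by move=> H; case: (leP y x) => [|/ltW] /H//; rewrite distrC (distrC x).
have [c _ ->] := @MVT_segment R cos (fun x => - sin x) y x xy
  (fun z _ => is_derive_cos z) (continuous_subspaceT (@continuous_cos R)).
by rewrite normrM normrN ler_piMl// sin_max.
Qed.

Let quarter_lt x : `|x| <= pi / 4 -> - (pi / 2) < x < pi / 2.
Proof. by have := pi_gt0 R; rewrite ler_norml => p /andP[a b]; apply/andP; split; lra. Qed.

Lemma cos_quarter_gt0 x : `|x| <= pi / 4 -> 0 < cos x.
Proof. by move=> /quarter_lt; exact: cos_gt0_pihalf. Qed.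

Lemma tan_quarter_le1 x : `|x| <= pi / 4 -> `|tan x| <= 1.
Proof.
have p := pi_gt0 R; rewrite !ler_norml => /andP[a b].
have le_tan u v : - (pi / 4) <= u -> u <= v -> v <= pi / 4 -> tan u <= tan v :> R.
  move=> u1; rewrite le_eqVlt => /predU1P[->//|uv] v1; apply/ltW.
  by rewrite ltr_tan// in_itv/=; apply/andP; split; lra.
have := le_tan (- (pi / 4)) x; have := le_tan x (pi / 4).
rewrite tanN tan_piquarter => h1 h2.
by apply/andP; split; [apply: h2|apply: h1] => //; lra.
Qed.

Lemma cos_quarter_inv_le2 x : `|x| <= pi / 4 -> (cos x)^-1 <= 2.
Proof.
move=> xq; have c0 := cos_quarter_gt0 xq; have t1 := tan_quarter_le1 xq.
have H := cos2_tan2 (lt0r_neq0 c0).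
have : (cos x)^-1 ^+ 2 <= 2 ^+ 2.
  rewrite exprVn H; have : tan x ^+ 2 <= 1 by rewrite -real_normK ?num_real// expr_le1.
  lra.
by rewrite ler_pXn2r ?nnegrE ?invr_ge0 ?(ltW c0).
Qed.

(** The derivative of [tan] is at least 1. *)
Lemma tan_expansive x y : `|x| <= pi / 4 -> `|y| <= pi / 4 -> `|x - y| <= `|tan x - tan y|.
Proof.
wlog xy : x y / y <= x.
  by move=> H hx hy; case: (leP y x) => [|/ltW] /H; [apply|rewrite distrC (distrC (tan x)); apply].
move=> hx hy.
have seg z : y <= z <= x -> `|z| <= pi / 4.
  by move: hx hy; rewrite !ler_norml => /andP[? ?] /andP[? ?] /andP[? ?]; apply/andP; split; lra.
have dt z : z \in `]y, x[ -> is_derive z 1 tan ((cos z)^-2).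
  rewrite in_itv/= => /andP[/ltW a /ltW b]; apply: is_derive_tan.
  by rewrite gt_eqF// cos_quarter_gt0// seg// a.
have ct : {within `[y, x], continuous (@tan R)}.
  apply: derivable_within_continuous => z; rewrite in_itv/= => zyx.
  by apply: derivable_tan; rewrite gt_eqF// cos_quarter_gt0// seg.
have [c cyx ->] := MVT_segment xy dt ct.
rewrite normrM ler_peMl//.
have c0 : 0 < cos c by rewrite cos_quarter_gt0// seg//; move: cyx; rewrite in_itv.
have c2 : 0 < cos c ^+ 2 by exact: exprn_gt0.
rewrite ger0_norm ?invr_ge0 ?(ltW c2)//.
by rewrite invf_ge1// expr_le1 ?cos_le1// ltW.
Qed.
End Trigonometry.

(** * Euclidean geometry of tubes *)

Section Tubes.
Variable R : realType.
Implicit Types (z w : R * R) (q : R * R).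

Lemma dot2_dir (theta : R) : dot2 (dir theta) (dir theta) = 1.
Proof. by rewrite /dot2 /dir/= -!expr2 cos2Dsin2. Qed.

Lemma proj_dirB (theta : R) z w :
  proj_dir theta z - proj_dir theta w = dot2 (z - w) (dir theta).
Proof. rewrite /proj_dir /dot2/=; ring. Qed.

Lemma dot2_sqr_le z w : dot2 z w ^+ 2 <= dot2 z z * dot2 w w.
Proof.
rewrite -subr_ge0; have -> : dot2 z z * dot2 w w - dot2 z w ^+ 2 =
  (z.1 * w.2 - z.2 * w.1) ^+ 2 by rewrite /dot2; ring.
exact: sqr_ge0.
Qed.

Lemma dot2_ge0 z : 0 <= dot2 z z.
Proof. by rewrite /dot2 -!expr2 addr_ge0// sqr_ge0. Qed.

Lemma edist2_ge0 z w : 0 <= edist2 z w. Proof. exact: sqrtr_ge0. Qed.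

Lemma proj_dir_le_edist2 (theta : R) z w :
  `|proj_dir theta z - proj_dir theta w| <= edist2 z w.
Proof.
rewrite proj_dirB -sqrtr_sqr ler_sqrt ?dot2_ge0//.
by apply: le_trans (dot2_sqr_le _ _) _; rewrite dot2_dir mulr1.
Qed.

(** The foot of the perpendicular from [z] realises the distance. *)
Lemma dist_to_line z q : dist_to z (line q) = `|proj_dir q.1 z - q.2|.
Proof.
set r := proj_dir q.1 z - q.2.
pose w : R * R := (z.1 - r * (dir q.1).1, z.2 - r * (dir q.1).2).
have d1 := dot2_dir q.1.
have wl : line q w.
  rewrite /line/= /proj_dir/=.
  have -> : dot2 w (dir q.1) = proj_dir q.1 z - r * dot2 (dir q.1) (dir q.1).
    by rewrite /proj_dir /dot2 /w/=; ring.
  by rewrite d1 /r; ring.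
have ew : edist2 z w = `|r|.
  rewrite /edist2 /enorm2; have -> : dot2 (z - w) (z - w) = r ^+ 2 * dot2 (dir q.1) (dir q.1).
    by rewrite /dot2 /w/=; ring.
  by rewrite d1 mulr1 sqrtr_sqr.
apply/eqP; rewrite eq_le; apply/andP; split.
  apply: ge_inf; last by exists w.
  by exists 0 => _ [v _ <-]; exact: edist2_ge0.
apply: lb_le_inf; first by exists (edist2 z w), w.
by move=> _ [v vl <-]; rewrite /r -vl; exact: proj_dir_le_edist2.
Qed.

Lemma edist2_le z w : edist2 z w <= `|z.1 - w.1| + `|z.2 - w.2|.
Proof.
rewrite /edist2 /enorm2 -[leRHS]ger0_norm ?addr_ge0// -sqrtr_sqr ler_sqrt ?sqr_ge0//.
rewrite /dot2/= -!expr2 [leRHS]sqrrD !real_normK ?num_real//.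
by rewrite -addrA lerD2l addrC lerDl mulrn_wge0// mulr_ge0.
Qed.

Lemma edist2_rotate (a : R) z w :
  edist2 z w = edist2 (z.2 * cos a - z.1 * sin a, z.1 * cos a + z.2 * sin a)
                      (w.2 * cos a - w.1 * sin a, w.1 * cos a + w.2 * sin a).
Proof.
rewrite /edist2 /enorm2; congr Num.sqrt.
rewrite -[LHS]mulr1 -(cos2Dsin2 a) /dot2/=; ring.
Qed.

Lemma unit_disc_le1 (a : R) z : unit_disc R z -> `|z.1 * cos a + z.2 * sin a| <= 1.
Proof.
rewrite /unit_disc/= => z1; apply: le_trans z1.
rewrite -sqrtr_sqr /enorm2 ler_sqrt ?dot2_ge0//.
have := dot2_sqr_le z (cos a, sin a); rewrite {1}/dot2/=.
by rewrite [dot2 (cos a, _) _]/dot2/= -!expr2 cos2Dsin2 mulr1.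
Qed.

Lemma unit_disc_le1' (a : R) z : unit_disc R z -> `|z.2 * cos a - z.1 * sin a| <= 1.
Proof.
rewrite /unit_disc/= => z1; apply: le_trans z1.
rewrite -sqrtr_sqr /enorm2 ler_sqrt ?dot2_ge0//.
have := dot2_sqr_le z (- sin a, cos a); rewrite {1}/dot2/=.
rewrite [dot2 (- sin a, _) _]/dot2/= mulrNN addrC -!expr2 [_ + cos a ^+ 2]addrC cos2Dsin2 mulr1.
by congr (_ ^+ 2 <= _); ring.
Qed.
End Tubes.

(** * The estimate in one chart *)

Lemma dyadic_scale (R : realType) (delta : R) : 0 < delta <= 1 ->
  exists N, delta <= (2 ^+ N)^-1 /\ (2 ^+ N)^-1 <= 2 * delta.
Proof.
move=> /andP[d0 d1].
have ex : exists n, (2 ^+ n)^-1 < delta.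
  have [n ndelta] : exists n : nat, delta^-1 < n%:R.
    by exists (Num.bound delta^-1); apply: archi_boundP; rewrite invr_ge0 ltW.
  exists n; rewrite -[ltRHS]invrK ltf_pV2 ?posrE ?invr_gt0 ?exprn_gt0//.
  by apply: lt_trans ndelta _; rewrite -natrX ltr_nat ltn_expl.
case: (ex_minnP ex) => [[|N]] Nd minN.
  by move: Nd; rewrite expr0 invr1 ltNge d1.
exists N; split.
  by rewrite leNgt; apply/negP => /minN; rewrite ltnn.
move: Nd; rewrite exprS invfM => /ltW; lra.
Qed.

Lemma riesz_kernel_ge (R : realType) (s r : R) (x y : R * R) : 0 < s -> 0 < r ->
  edist2 x y <= r -> ((r `^ (- s))%:E <= riesz_kernel s x y)%E.
Proof.
move=> s0 r0 xyr; rewrite /riesz_kernel inver; case: eqP => [_|/eqP n0]; first exact: leey.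
rewrite lee_fin powRN lef_pV2 ?posrE ?(powR_gt0 _ r0)//.
  by apply: ge0_ler_powR; rewrite ?nnegrE ?edist2_ge0 ?(ltW s0) ?(ltW r0).
by rewrite lt_def n0 powR_ge0.
Qed.

Section GridCell.
Variables (R : realType) (p : R) (f g : R * R -> R) (D : set (R * R)).

Definition grid_cell (x y : int) : set (R * R) :=
  (D `&` (fun z => p ^+ 2 * f z) @^-1` `[x%:~R, (x + 1)%:~R[) `&`
  (D `&` (fun z => p ^+ 4 * g z) @^-1` `[y%:~R, (y + 1)%:~R[).

Lemma grid_cellP x y z : grid_cell x y z <->
  [/\ D z, x = Num.floor (p ^+ 2 * f z) & y = Num.floor (p ^+ 4 * g z)].
Proof.
split.
  case=> -[Dz]; rewrite /= !in_itv/= => fz [_ gz].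
  by split => //; apply/esym; apply: floor_def.
by case=> Dz -> ->; split; split => //=; rewrite in_itv/= floor_itv.
Qed.

Lemma measurable_grid_cell x y : measurable D -> measurable_fun D f -> measurable_fun D g ->
  measurable (grid_cell x y).
Proof.
move=> mD mf mg; apply: measurableI.
  by apply: (measurable_funM (measurable_cst _) mf) => //; exact: measurable_itv.
by apply: (measurable_funM (measurable_cst _) mg) => //; exact: measurable_itv.
Qed.
End GridCell.

(** Rounding moves each coordinate by less than one unit of the lattice, and the
units are below the cutoff [1 / P] of [cell_dist]. *)
Lemma dist_le_cell_dist (R : realType) (N : nat) (x y x' y' : int) (u v u' v' : R) :
  let p : R := (2 ^+ N : int)%:~R in
  x = Num.floor (p ^+ 2 * u) -> y = Num.floor (p ^+ 4 * v) ->
  x' = Num.floor (p ^+ 2 * u') -> y' = Num.floor (p ^+ 4 * v') ->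
  `|u - u'| + `|v - v'| <= 4 * cell_dist R N x y x' y'.
Proof.
move=> p xE yE xE' yE'.
have p1 : 1 <= p by rewrite ler1z exprn_ege1.
have p0 : 0 < p by exact: lt_le_trans p1.
have close (z z' : R) (k k' : int) : k = Num.floor z -> k' = Num.floor z' -> `|z - z'| <= `|k - k'|%:~R + 1.
  move=> kE kE'; have := floor_itv z; have := floor_itv z'; rewrite -kE -kE' !intrD.
  move=> /andP[a b] /andP[c d]; rewrite intr_norm rmorphB/=.
  have := ler_norm (k%:~R - k'%:~R : R); have := ler_norm (- (k%:~R - k'%:~R : R)); rewrite normrN.
  move: (`|_|) => w ? ?; rewrite ler_norml; apply/andP; split; lra.
have cu : p ^+ 2 * `|u - u'| <= `|x - x'|%:~R + 1.
  by have := close _ _ _ _ xE xE'; rewrite -mulrBr normrM ger0_norm ?exprn_ge0// ltW.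
have cv : p ^+ 4 * `|v - v'| <= `|y - y'|%:~R + 1.
  by have := close _ _ _ _ yE yE'; rewrite -mulrBr normrM ger0_norm ?exprn_ge0// ltW.
set r := gap ((2 ^+ N) ^+ 2) ((2 ^+ N) ^+ 3) x y x' y'.
have r1 : (p ^+ 3) <= r%:~R.
  by rewrite /p -rmorphXn ler_int /r /gap !le_max lexx orbT.
have r2 : p ^+ 2 * `|x - x'|%:~R <= r%:~R.
  by rewrite /p -rmorphXn -rmorphM ler_int /r /gap !le_max lexx.
have r3 : `|y - y'|%:~R <= r%:~R :> R.
  by rewrite ler_int /r /gap !le_max lexx orbT.
have -> : cell_dist R N x y x' y' = r%:~R / p ^+ 4 by [].
rewrite mulrA ler_pdivlMr ?exprn_gt0// mulrC mulrDr.
have -> : p ^+ 4 * `|u - u'| = p ^+ 2 * (p ^+ 2 * `|u - u'|) by ring.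
have p23 : p ^+ 2 <= p ^+ 3 by rewrite ler_weXn2l.
have p13 : 1 <= p ^+ 3 by rewrite exprn_ege1.
have : p ^+ 2 * (p ^+ 2 * `|u - u'|) <= p ^+ 2 * (`|x - x'|%:~R + 1).
  by rewrite ler_wpM2l// exprn_ge0// ltW.
rewrite mulrDr mulr1; lra.
Qed.

Lemma norm_floor_le (R : realType) (v : R) (k : int) : `|v| <= k%:~R -> `|Num.floor v| <= k.
Proof.
rewrite !ler_norml => /andP[a b]; have /andP[c _] := floor_itv v; apply/andP; split.
  by rewrite floor_ge_int rmorphN.
by rewrite -(ler_int R) (le_trans c).
Qed.

(** The constant is [2 + 1 + 1 + 1 + 2]: the tube, the roundings of [g] and [b],
and the two errors in the product [a * f]. *)
Lemma cell_incident (R : realType) (p d f g a b : R) (x y al be : int) :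
  1 <= p -> `|f| <= 1 -> `|a| <= 1 -> d <= p^-1 -> `|g - a * f - b| <= 2 * d ->
  x = Num.floor (p ^+ 2 * f) -> y = Num.floor (p ^+ 4 * g) ->
  al = Num.floor (p ^+ 2 * a) -> be = Num.floor (p ^+ 4 * b) ->
  `|y%:~R - al%:~R * x%:~R - be%:~R| <= 7 * p ^+ 3.
Proof.
move=> p1 f1 a1 dp inc xE yE aE bE.
have p0 : 0 < p by exact: lt_le_trans p1.
have p20 : 0 <= p ^+ 2 by rewrite exprn_ge0// ltW.
have frac (z : R) (k : int) : k = Num.floor z -> 0 <= z - k%:~R <= 1.
  by have := floor_itv z => + kE; rewrite -kE intrD => /andP[? ?]; apply/andP; split; lra.
have /andP[x0 x1] := frac _ _ xE; have /andP[y0 y1] := frac _ _ yE.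
have /andP[a0 a1'] := frac _ _ aE; have /andP[b0 b1] := frac _ _ bE.
have p3 : p ^+ 2 <= p ^+ 3 by rewrite ler_weXn2l.
have p31 : 1 <= p ^+ 2 by rewrite exprn_ege1.
set x' := p ^+ 2 * f - x%:~R in x0 x1; set y' := p ^+ 4 * g - y%:~R in y0 y1.
set a' := p ^+ 2 * a - al%:~R in a0 a1'; set b' := p ^+ 4 * b - be%:~R in b0 b1.
have pf : `|p ^+ 2 * f| <= p ^+ 2 by rewrite normrM ger0_norm// ler_piMr.
have pa : `|p ^+ 2 * a| <= p ^+ 2 by rewrite normrM ger0_norm// ler_piMr.
have T1 : `|p ^+ 4 * (g - a * f - b)| <= 2 * p ^+ 3.
  rewrite normrM ger0_norm ?exprn_ge0 ?(ltW p0)//.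
  apply: (@le_trans _ _ (p ^+ 4 * (2 * p^-1))).
    by rewrite ler_wpM2l ?exprn_ge0 ?(ltW p0)//; apply: le_trans inc _; lra.
  by rewrite le_eqVlt; apply/orP; left; apply/eqP; field; rewrite gt_eqF.
have T2 : `|p ^+ 2 * a * x'| <= p ^+ 2.
  by rewrite normrM -[leRHS]mulr1 ler_pM// ger0_norm.
have T3 : `|a' * x%:~R| <= 2 * p ^+ 2.
  rewrite normrM -[leRHS]mul1r ler_pM//; first by rewrite ger0_norm.
  have -> : x%:~R = p ^+ 2 * f - x' by rewrite /x'; ring.
  by move: pf; rewrite !ler_norml => /andP[? ?]; apply/andP; split; lra.
have -> : y%:~R - al%:~R * x%:~R - be%:~R =
    p ^+ 4 * (g - a * f - b) - y' + b' + p ^+ 2 * a * x' + a' * x%:~R.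
  by rewrite /x' /y' /a' /b'; ring.
move: T1 T2 T3; move: (_ * (g - _ - b)) (_ * x') (a' * _) => u v w.
by rewrite !ler_norml => /andP[? ?] /andP[? ?] /andP[? ?]; apply/andP; split; lra.
Qed.

Section Charted.
Variables (R : realType) (t : R).
Hypotheses (t1 : 1 < t) (t2 : t < 2).

Let C : R := discrete_const t.

Let const_ge0 : 0 <= C.
Proof.
have e0 : 0 < 2 - t by rewrite subr_gt0.
have e1 : 0 < 1 - (2 - t) by rewrite (_ : 1 - (2 - t) = t - 1) ?subr_gt0//; ring.
have geom (x : R) : 0 < x -> 0 <= 2 `^ x / (2 `^ x - 1).
  by move=> x0; rewrite divr_ge0 ?powR_ge0// subr_ge0 ltW// powR_gt1.
rewrite /C /discrete_const; apply: mulr_ge0; last by apply: geom; exact: lt_trans t1.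
apply: mulr_ge0; first by rewrite ler0z; apply: mulr_ge0 => //; apply: mulr_ge0 => //; exact: kernel_const_ge0.
apply: addr_ge0 => //; apply: mulr_ge0 => //; apply: addr_ge0; first exact: geom.
by rewrite invr_ge0 subr_ge0 ltW// powRN_lt1.
Qed.

Definition chart_const : R := 2 * Num.sqrt (C * 12 ^+ 3).

Variables (mu nu : {finite_measure set (R * R)%type -> \bar R}).
Variables (D E : set (R * R)) (f g a b : R * R -> R).
Hypotheses (mD : measurable D) (mE : measurable E).
Hypotheses (mf : measurable_fun D f) (mg : measurable_fun D g).
Hypotheses (ma : measurable_fun E a) (mb : measurable_fun E b).
Hypotheses (f1 : forall z, D z -> `|f z| <= 1) (g1 : forall z, D z -> `|g z| <= 1).
Hypotheses (a1 : forall q, E q -> `|a q| <= 1) (b2 : forall q, E q -> `|b q| <= 2).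
Hypothesis fg_expansive : forall z z', D z -> D z' ->
  edist2 z z' <= 3 * (`|f z - f z'| + `|g z - g z'|).
Hypothesis ab_expansive : forall q q', E q -> E q' ->
  edist2 q q' <= 3 * (`|a q - a q'| + `|b q - b q'|).

(** The discrete estimate is applied to the masses of the cells. A Riesz kernel
of exponent [s] is at least [(12 * d) ^ -s] on a product of cells at distance
[d], since the inverse chart and the rounding lose factors [3] and [4]; the two
exponents add up to [3], whence the factor [12 ^+ 3] in [chart_const]. *)
Lemma charted_incidence (delta : R) (S : set ((R * R) * (R * R))) :
  0 < delta <= 1 -> measurable S ->
  (forall z q, S (z, q) -> [/\ D z, E q & `|g z - a q * f z - b q| <= 2 * delta]) ->
  ((mu \x nu) S <= chart_const%:E * delta%:E *
    sqrte (riesz_energy (3 - t) mu * riesz_energy t nu))%E.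
Proof.
move=> d01 mS inS; have [N [dN Nd]] := dyadic_scale d01.
pose P : int := 2 ^+ N; pose p : R := P%:~R.
have pE : p = 2 ^+ N by rewrite /p /P rmorphXn.
have p0 : 0 < p by rewrite pE exprn_gt0.
have dN' : delta <= p^-1 by rewrite pE.
have P1 : 1 <= P by exact: exprn_ege1.
pose K1 := absz (P ^+ 2); pose K2 := absz ((P ^+ 2) ^+ 2).
pose K3 := absz (2 * (P ^+ 2) ^+ 2).
pose I := (seq_sub (zrange K1) * seq_sub (zrange K2))%type.
pose J := (seq_sub (zrange K1) * seq_sub (zrange K3))%type.
pose X (i : I) : int := ssval i.1; pose Y (i : I) : int := ssval i.2.
pose A (j : J) : int := ssval j.1; pose B (j : J) : int := ssval j.2.
pose SI (i : I) := grid_cell p f g D (X i) (Y i).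
pose TJ (j : J) := grid_cell p a b E (A j) (B j).
have mSI i : measurable (SI i) by exact: measurable_grid_cell.
have mTJ j : measurable (TJ j) by exact: measurable_grid_cell.
have injI (i i' : I) z : SI i z -> SI i' z -> i = i'.
  move=> /grid_cellP[_ x y] /grid_cellP[_ x' y']; rewrite -x in x'; rewrite -y in y'.
  by case: i i' {x y} x' y' => [i1 i2] [i1' i2'] x y; congr pair; apply: val_inj.
have injJ (j j' : J) q : TJ j q -> TJ j' q -> j = j'.
  move=> /grid_cellP[_ x y] /grid_cellP[_ x' y']; rewrite -x in x'; rewrite -y in y'.
  by case: j j' {x y} x' y' => [i1 i2] [i1' i2'] x y; congr pair; apply: val_inj.
have Q0 : 0 <= P ^+ 2 by rewrite exprn_ge0// (le_trans _ P1).
have Q20 : 0 <= (P ^+ 2) ^+ 2 by exact: exprn_ge0.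
have XQ i : `|X i| <= P ^+ 2 by have := ssvalP i.1; rewrite mem_zrange gez0_abs.
have YQ i : `|Y i| <= (P ^+ 2) ^+ 2 by have := ssvalP i.2; rewrite mem_zrange gez0_abs.
have AQ j : `|A j| <= P ^+ 2 by have := ssvalP j.1; rewrite mem_zrange gez0_abs.
have BQ j : `|B j| <= 2 * (P ^+ 2) ^+ 2.
  by have := ssvalP j.2; rewrite mem_zrange gez0_abs// mulr_ge0.
have p2E : p ^+ 2 = (P ^+ 2)%:~R by rewrite (rmorphXn _ 2 P).
have p4E : p ^+ 4 = ((P ^+ 2) ^+ 2)%:~R by rewrite -exprM (rmorphXn _ 4 P).
have coverI z : D z -> exists i, SI i z.
  move=> Dz.
  have xm : Num.floor (p ^+ 2 * f z) \in zrange K1.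
    rewrite mem_zrange gez0_abs//; apply: norm_floor_le.
    by rewrite normrM p2E ger0_norm ?ler0z// ler_piMr ?ler0z// f1.
  have ym : Num.floor (p ^+ 4 * g z) \in zrange K2.
    rewrite mem_zrange gez0_abs//; apply: norm_floor_le.
    by rewrite normrM p4E ger0_norm ?ler0z// ler_piMr ?ler0z// g1.
  by exists (SeqSub xm, SeqSub ym); apply/grid_cellP.
have coverJ q : E q -> exists j, TJ j q.
  move=> Eq.
  have xm : Num.floor (p ^+ 2 * a q) \in zrange K1.
    rewrite mem_zrange gez0_abs//; apply: norm_floor_le.
    by rewrite normrM p2E ger0_norm ?ler0z// ler_piMr ?ler0z// a1.
  have ym : Num.floor (p ^+ 4 * b q) \in zrange K3.
    rewrite mem_zrange gez0_abs; last by rewrite mulr_ge0.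
    apply: norm_floor_le.
    by rewrite normrM p4E ger0_norm ?ler0z// [leRHS]rmorphM [leLHS]mulrC ler_wpM2r ?ler0z// b2.
  by exists (SeqSub xm, SeqSub ym); apply/grid_cellP.
pose m i := fine (mu (SI i)); pose n j := fine (nu (TJ j)).
have m0 i : 0 <= m i by exact: fine_ge0.
have n0 j : 0 <= n j by exact: fine_ge0.
pose inc i j := `|Y i - A j * X i - B j| <= 7 * P ^+ 3.
pose Sum := \sum_i \sum_j m i * n j * (inc i j)%:R.
have up : ((mu \x nu) S <= Sum%:E)%E.
  apply: product_measure_le_cells => // z q /inS[Dz Eq zq].
  have [i Si] := coverI _ Dz; have [j Tj] := coverJ _ Eq; exists i, j; split => //.
  move: Si Tj => /grid_cellP[_ xE yE] /grid_cellP[_ AE BE].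
  have p1 : 1 <= p by rewrite ler1z.
  have := cell_incident p1 (f1 Dz) (a1 Eq) dN' zq xE yE AE BE.
  have P7 : (7 * P ^+ 3)%:~R = 7 * p ^+ 3 :> R by rewrite rmorphM (rmorphXn _ 3 P).
  by rewrite /inc -(ler_int R) intr_norm P7 !rmorphB rmorphM.
pose dI i i' := cell_dist R N (X i) (Y i) (X i') (Y i').
pose dJ j j' := cell_dist R N (A j) (B j) (A j') (B j').
have d_gt0 x y x' y' : 0 < cell_dist R N x y x' y'.
  rewrite /cell_dist/= -/P divr_gt0 ?ltr0z//; last by rewrite exprn_gt0.
  by rewrite /gap !lt_max; apply/orP; right; rewrite exprn_gt0.
have energyI : ((12 `^ (- (3 - t)) * \sum_i \sum_i' m i * m i' * dI i i' `^ (- (3 - t)))%:E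
    <= riesz_energy (3 - t) mu)%E.
  apply: le_trans (@sum_cells_le_energy R (3 - t) mu I SI
    (fun i i' => (12 * dI i i') `^ (- (3 - t))) mSI injI _ _).
  - rewrite lee_fin mulr_sumr; apply: ler_sum => i _.
    rewrite mulr_sumr; apply: ler_sum => i' _.
    by rewrite powRM// ?(ltW (d_gt0 _ _ _ _))// mulrCA.
  - by move=> i i'; exact: powR_ge0.
  move=> i i' z z' /grid_cellP[Dz xE yE] /grid_cellP[Dz' xE' yE'].
  apply: riesz_kernel_ge; [by rewrite subr_gt0 (lt_trans t2)// ltr_nat|by apply: mulr_gt0 => //; exact: d_gt0|].
  apply: le_trans (fg_expansive Dz Dz') _.
  have := dist_le_cell_dist xE yE xE' yE'; rewrite -/(dI i i'); lra.
have energyJ : ((12 `^ (- t) * \sum_j \sum_j' n j * n j' * dJ j j' `^ (- t))%:E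
    <= riesz_energy t nu)%E.
  apply: le_trans (@sum_cells_le_energy R t nu J TJ
    (fun j j' => (12 * dJ j j') `^ (- t)) mTJ injJ _ _).
  - rewrite lee_fin mulr_sumr; apply: ler_sum => i _.
    rewrite mulr_sumr; apply: ler_sum => i' _.
    by rewrite powRM// ?(ltW (d_gt0 _ _ _ _))// mulrCA.
  - by move=> i i'; exact: powR_ge0.
  move=> i i' z z' /grid_cellP[Dz xE yE] /grid_cellP[Dz' xE' yE'].
  apply: riesz_kernel_ge; [exact: lt_trans t1|by apply: mulr_gt0 => //; exact: d_gt0|].
  apply: le_trans (ab_expansive Dz Dz') _.
  have := dist_le_cell_dist xE yE xE' yE'; rewrite -/(dJ i i'); lra.
have main := discrete_incidence_le m0 n0 XQ YQ AQ BQ t1 t2.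
rewrite -/P -/p -/C in main.
move: energyI energyJ main; rewrite -/dI -/dJ -/Sum.
set E1 := \sum_i _; set E2 := \sum_j _ => energyI energyJ main.
have E10 : 0 <= E1.
  by apply: sumr_ge0 => i _; apply: sumr_ge0 => i' _; rewrite !mulr_ge0// powR_ge0.
have E20 : 0 <= E2.
  by apply: sumr_ge0 => i _; apply: sumr_ge0 => i' _; rewrite !mulr_ge0// powR_ge0.
have Sum0 : 0 <= Sum.
  by apply: sumr_ge0 => i _; apply: sumr_ge0 => j _; rewrite !mulr_ge0.
pose e1 := 12 `^ (- (3 - t)) * E1; pose e2 := 12 `^ (- t) * E2.
have e10 : 0 <= e1 by rewrite mulr_ge0// powR_ge0.
have e20 : 0 <= e2 by rewrite mulr_ge0// powR_ge0.
have e12 : E1 * E2 = 12 ^+ 3 * (e1 * e2).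
  have -> : 12 ^+ 3 * (e1 * e2) = 12 ^+ 3 * (12 `^ (- (3 - t)) * 12 `^ (- t)) * (E1 * E2).
    by rewrite /e1 /e2; move: (12 `^ _) (12 `^ (- t)) => x y; ring.
  rewrite -powRD ?pnatr_eq0 ?implybT//.
  have -> : - (3 - t) + - t = - (3%:R) by ring.
  by rewrite powRN powR_mulrn// mulfV ?mul1r// expf_neq0// pnatr_eq0.
have SumLe : Sum <= chart_const * delta * Num.sqrt (e1 * e2).
  have : p * Sum <= Num.sqrt (C * 12 ^+ 3) * Num.sqrt (e1 * e2).
    have C0 : 0 <= C by exact: const_ge0.
    have C12 : 0 <= C * 12 ^+ 3 by rewrite mulr_ge0// exprn_ge0.
    rewrite -sqrtrM// -[leLHS]ger0_norm ?mulr_ge0 ?(ltW p0)// -sqrtr_sqr.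
    rewrite ler_sqrt; last by rewrite mulr_ge0// mulr_ge0.
    by apply: le_trans main _; rewrite e12 mulrA.
  move=> H; have pd : 1 <= 2 * delta * p.
    by rewrite -ler_pdivrMr// mul1r pE.
  apply: (@le_trans _ _ (2 * delta * (p * Sum))).
    by rewrite mulrA ler_peMl.
  have -> : chart_const * delta * Num.sqrt (e1 * e2) =
    2 * delta * (Num.sqrt (C * 12 ^+ 3) * Num.sqrt (e1 * e2)) by rewrite /chart_const; ring.
  by rewrite ler_wpM2l// mulr_ge0//; case/andP: d01 => /ltW.
apply: le_trans up _; apply: (@le_trans _ _ ((chart_const * delta * Num.sqrt (e1 * e2))%:E)).
  by rewrite lee_fin.
rewrite !EFinM; apply: lee_pmul => //.
  rewrite -EFinM lee_fin; apply: mulr_ge0; last by case/andP: d01 => /ltW.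
  by apply: mulr_ge0 => //; exact: sqrtr_ge0.
have -> : (Num.sqrt (e1 * e2))%:E = sqrte (e1 * e2)%:E by [].
rewrite lee_sqrt; last by rewrite mule_ge0// (le_trans _ energyI, le_trans _ energyJ) ?lee_fin.
by rewrite EFinM; apply: lee_pmul; rewrite ?lee_fin.
Qed.
End Charted.

(** * The two charts *)

Lemma measurable_unit_disc (R : realType) : measurable (unit_disc R).
Proof.
have -> : unit_disc R = setT `&` (fun z : R * R => z.1 * z.1 + z.2 * z.2) @^-1` `]-oo, 1].
  apply/seteqP; split => z; rewrite /unit_disc /enorm2 /= in_itv/=.
    by move=> z1; split => //; rewrite -ler_sqrt// sqrtr1.
  by move=> [_ z1]; rewrite -[leRHS]sqrtr1 ler_sqrt.
have : measurable_fun setT (fun z : R * R => z.1 * z.1 + z.2 * z.2).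
  by apply: measurable_funD; apply: measurable_funM.
by apply => //; exact: measurable_itv.
Qed.

Lemma measurable_proj_dir (R : realType) :
  measurable_fun setT (fun zq : (R * R) * (R * R) => proj_dir zq.2.1 zq.1 - zq.2.2).
Proof.
have m2 : measurable_fun setT (fun zq : (R * R) * (R * R) => 2 * pi * zq.2.1).
  apply: measurable_funM => //.
  by apply: measurableT_comp => //.
rewrite /proj_dir /dot2/=; apply: measurable_funB; last exact: measurableT_comp.
apply: measurable_funD; apply: measurable_funM; try exact: measurableT_comp.
  apply: (measurableT_comp _ m2); apply: continuous_measurable_fun; exact: continuous_cos.
apply: (measurableT_comp _ m2); apply: continuous_measurable_fun; exact: continuous_sin.
Qed.

Lemma measurable_incidence (R : realType) (delta : R) :
  measurable [set zq : (R * R) * (R * R) | tube delta zq.2 zq.1].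
Proof.
have -> : [set zq : (R * R) * (R * R) | tube delta zq.2 zq.1] = setT `&`
    (fun zq : (R * R) * (R * R) => proj_dir zq.2.1 zq.1 - zq.2.2) @^-1` `[- delta, delta].
  apply/seteqP; split => zq; rewrite /tube/= dist_to_line in_itv/= ler_norml//.
  by case.
by apply: measurable_proj_dir => //; exact: measurable_itv.
Qed.

Section Chart.
Variables (R : realType) (theta0 : R).
Let a : R := 2 * pi * theta0.
Let psi (q : R * R) : R := 2 * pi * (q.1 - theta0).

(** In the frame rotated by [theta0], the line with parameters [(theta, r)] is
the graph [y = slope * x + intercept]; [psi] is its angle to the frame, at most
[pi / 4] in absolute value. *)
Definition chart_lines : set (R * R) :=
  `[theta0 - 1 / 8, theta0 + 1 / 8] `*` `[-1, 1].
Definition chart_slope (q : R * R) : R := - tan (psi q).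
Definition chart_intercept (q : R * R) : R := q.2 * (cos (psi q))^-1.
Definition chart_x (z : R * R) : R := z.2 * cos a - z.1 * sin a.
Definition chart_y (z : R * R) : R := z.1 * cos a + z.2 * sin a.

Lemma chart_linesP q : chart_lines q <-> `|q.1 - theta0| <= 1 / 8 /\ `|q.2| <= 1.
Proof.
rewrite /chart_lines /= !in_itv/= !ler_norml; split.
  by move=> [/andP[? ?] ->]; split => //; apply/andP; split; lra.
by move=> [/andP[? ?] ->]; split => //; apply/andP; split; lra.
Qed.

Lemma psi_quarter q : chart_lines q -> `|psi q| <= pi / 4.
Proof.
move=> /chart_linesP[q1 _]; have p := pi_gt0 R.
rewrite /psi normrM ger0_norm ?mulr_ge0 ?(ltW p)//.
apply: (@le_trans _ _ (2 * pi * (1 / 8))).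
  by rewrite ler_wpM2l// mulr_ge0// ltW.
lra.
Qed.

Lemma measurable_chart_lines : measurable chart_lines.
Proof. by apply: measurableX; exact: measurable_itv. Qed.

Let psi_in q : chart_lines q -> psi q \in `]- (pi / 2), pi / 2[.
Proof.
move=> /psi_quarter; rewrite in_itv/= ler_norml; have p := pi_gt0 R.
by move=> /andP[? ?]; apply/andP; split; lra.
Qed.

Let mpsi : measurable_fun chart_lines psi.
Proof.
apply: measurable_funTS; apply: measurable_funM => //.
by apply: measurable_funB.
Qed.

Let cos_neq0 (x : R) : x \in `]- (pi / 2), pi / 2[ -> cos x != 0.
Proof. by rewrite in_itv/= => /cos_gt0_pihalf/lt0r_neq0. Qed.

Let meas_comp (h : R -> R) :
  {in `]- (pi / 2), pi / 2[, continuous h} -> measurable_fun chart_lines (h \o psi).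
Proof.
move=> ch; apply: (@measurable_comp _ _ _ _ _ _ `]- (pi / 2), pi / 2[) => //.
  by move=> _ [q Eq <-]; exact: psi_in.
apply: open_continuous_measurable_fun; first exact: interval_open.
by move=> x; rewrite inE/= => /ch.
Qed.

Lemma measurable_chart_slope : measurable_fun chart_lines chart_slope.
Proof.
apply: measurableT_comp => //; apply: meas_comp => x xin.
by apply: continuous_tan; exact: cos_neq0.
Qed.

Lemma measurable_chart_intercept : measurable_fun chart_lines chart_intercept.
Proof.
apply: measurable_funM; first exact: measurable_funTS.
apply: (@meas_comp (fun x => (cos x)^-1)) => x xin.
by apply: cvgV; [exact: cos_neq0|exact: continuous_cos].
Qed.

Lemma measurable_chart_x (D : set (R * R)) : measurable_fun D chart_x.
Proof.
by apply: measurable_funTS; apply: measurable_funB; apply: measurable_funM.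
Qed.

Lemma measurable_chart_y (D : set (R * R)) : measurable_fun D chart_y.
Proof.
by apply: measurable_funTS; apply: measurable_funD; apply: measurable_funM.
Qed.

Lemma chart_slope_le1 q : chart_lines q -> `|chart_slope q| <= 1.
Proof. by move=> /psi_quarter/tan_quarter_le1; rewrite /chart_slope normrN. Qed.

Lemma chart_intercept_le2 q : chart_lines q -> `|chart_intercept q| <= 2.
Proof.
move=> Eq; have [_ q2] := (chart_linesP q).1 Eq; have h := psi_quarter Eq.
have c0 := cos_quarter_gt0 h; have c2 := cos_quarter_inv_le2 h.
rewrite /chart_intercept normrM -[leRHS]mul1r ler_pM//.
by rewrite ger0_norm// invr_ge0 ltW.
Qed.

(** The angle is recovered from the slope by [tan_expansive], and the second
parameter as intercept times cosine. *)
Lemma chart_expansive_lines q q' : chart_lines q -> chart_lines q' ->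
  edist2 q q' <= 3 * (`|chart_slope q - chart_slope q'| +
                      `|chart_intercept q - chart_intercept q'|).
Proof.
move=> Eq Eq'; apply: le_trans (edist2_le _ _) _.
have h := psi_quarter Eq; have h' := psi_quarter Eq'.
have c0 := lt0r_neq0 (cos_quarter_gt0 h); have c0' := lt0r_neq0 (cos_quarter_gt0 h').
have dpsi : `|psi q - psi q'| <= `|chart_slope q - chart_slope q'|.
  by rewrite /chart_slope -opprD normrN; exact: tan_expansive.
have dtheta : `|q.1 - q'.1| <= `|psi q - psi q'|.
  have -> : psi q - psi q' = 2 * pi * (q.1 - q'.1) by rewrite /psi; ring.
  rewrite normrM ler_peMl//; have := pi_ge2 R; have := pi_gt0 R => p0 p2.
  by rewrite ger0_norm ?mulr_ge0 ?(ltW p0)//; lra.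
have dr : `|q.2 - q'.2| <= `|chart_intercept q - chart_intercept q'| + 2 * `|psi q - psi q'|.
  have -> : q.2 - q'.2 = (chart_intercept q - chart_intercept q') * cos (psi q) +
      chart_intercept q' * (cos (psi q) - cos (psi q')).
    by rewrite /chart_intercept; field; rewrite c0 c0'.
  apply: le_trans (ler_normD _ _) _; apply: lerD.
    by rewrite normrM ler_piMr// cos_max.
  by rewrite normrM; apply: ler_pM => //; [exact: chart_intercept_le2|exact: cos_lip].
have : 0 <= `|chart_intercept q - chart_intercept q'| by [].
have : 0 <= `|chart_slope q - chart_slope q'| by [].
lra.
Qed.

Lemma chart_expansive_points z z' :
  edist2 z z' <= 3 * (`|chart_x z - chart_x z'| + `|chart_y z - chart_y z'|).
Proof.
rewrite (edist2_rotate a) -/(chart_x z) -/(chart_y z) -/(chart_x z') -/(chart_y z').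
apply: le_trans (edist2_le _ _) _; rewrite /= ler_peMl ?addr_ge0//; lra.
Qed.

Lemma chart_incident (delta : R) z q : chart_lines q -> 0 <= delta -> tube delta q z ->
  `|chart_y z - chart_slope q * chart_x z - chart_intercept q| <= 2 * delta.
Proof.
move=> Eq d0; rewrite /tube/= dist_to_line => zq.
have h := psi_quarter Eq; have c0 := cos_quarter_gt0 h; have c2 := cos_quarter_inv_le2 h.
have -> : chart_y z - chart_slope q * chart_x z - chart_intercept q =
    (proj_dir q.1 z - q.2) * (cos (psi q))^-1.
  have qE : 2 * pi * q.1 = a + psi q by rewrite /a /psi; ring.
  rewrite /proj_dir /dot2 /dir/= qE cosD sinD /chart_y /chart_slope /chart_x /chart_intercept /tan.
  by field; rewrite gt_eqF.
rewrite normrM mulrC ler_pM// ger0_norm// invr_ge0 ltW//.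
Qed.
End Chart.

Theorem theorem1p7 (R : realType) (t : R) (ht : 1 < t < 2) :
  exists2 A : R, 0 < A &
    forall (mu nu : {finite_measure set (R * R)%type -> \bar R}) (delta : R),
      mu (~` unit_disc R) = 0%E ->
      nu (~` (`[1 / 4, 3 / 4] `*` `[-1, 1])) = 0%E ->
      0 < delta <= 1 / 50 ->
      (incidences delta mu nu <=
       A%:E * delta%:E * sqrte (riesz_energy (3 - t) mu * riesz_energy t nu))%E.
Proof.
have /andP[t1 t2] := ht.
have c0 : 0 <= chart_const t by rewrite mulr_ge0// sqrtr_ge0.
exists (2 * chart_const t + 1) => [|mu nu delta muD nuE /andP[d0 d1]].
  by rewrite ltr_wpDl// mulr_ge0.
have d01 : 0 < delta <= 1 by apply/andP; split => //; lra.
pose D := unit_disc R; have mD : measurable D := @measurable_unit_disc R.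
pose St : set (R * R) := `[1 / 4, 3 / 4] `*` `[-1, 1].
have mSt : measurable St by apply: measurableX; exact: measurable_itv.
pose Inc := [set zq : (R * R) * (R * R) | tube delta zq.2 zq.1].
have mInc : measurable Inc := @measurable_incidence R delta.
pose S theta0 := Inc `&` (D `*` chart_lines theta0).
have mS theta0 : measurable (S theta0).
  by apply: measurableI => //; apply: measurableX => //; exact: measurable_chart_lines.
set X := sqrte _.
have S_le theta0 : ((mu \x nu) (S theta0) <= (chart_const t)%:E * delta%:E * X)%E.
  apply: (@charted_incidence R t t1 t2 mu nu D (chart_lines theta0)
    (chart_x theta0) (chart_y theta0) (chart_slope theta0) (chart_intercept theta0)) => //.
  - exact: measurable_chart_lines.
  - exact: measurable_chart_x.
  - exact: measurable_chart_y.
  - exact: measurable_chart_slope.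
  - exact: measurable_chart_intercept.
  - by move=> z; exact: unit_disc_le1'.
  - by move=> z; exact: unit_disc_le1.
  - exact: chart_slope_le1.
  - exact: chart_intercept_le2.
  - by move=> z z' _ _; exact: chart_expansive_points.
  - exact: chart_expansive_lines.
  - by move=> z q [zq [Dz Eq]]; split => //; apply: chart_incident => //; exact: ltW.
(* The charts around 3/8 and 5/8 share the directions out evenly. *)
have cover : Inc `<=` (S (3 / 8) `|` S (5 / 8)) `|` ((~` D) `*` setT `|` setT `*` (~` St)).
  move=> [z q] zq.
  have [Dz|nDz] := pselect (D z); last by right; left.
  have [Eq|nEq] := pselect (St q); last by right; right.
  left; move: Eq => [/=]; rewrite !in_itv/= => /andP[q1 q3] /andP[r1 r2].
  have [qle|qgt] := leP q.1 (1 / 2).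
    left; split => //; split => //; apply/chart_linesP; rewrite !ler_norml.
    by split; apply/andP; split; lra.
  right; split => //; split => //; apply/chart_linesP; rewrite !ler_norml.
  by split; apply/andP; split; lra.
have mND : measurable ((~` D) `*` [set: R * R]).
  by apply: measurableX => //; exact: measurableC.
have mNS : measurable ([set: R * R] `*` (~` St)).
  by apply: measurableX => //; exact: measurableC.
have nullD : (mu \x nu)%E ((~` D) `*` [set: R * R]) = 0%E.
  rewrite product_measure1E//; last exact: measurableC.
  by rewrite [X in (X * _)%E](_ : _ = 0%E) ?mul0e//; exact: muD.
have nullS : (mu \x nu)%E ([set: R * R] `*` (~` St)) = 0%E.
  rewrite product_measure1E//; last exact: measurableC.
  by rewrite [X in (_ * X)%E](_ : _ = 0%E) ?mule0//; exact: nuE.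
have mS12 : measurable (S (3 / 8) `|` S (5 / 8)) by exact: measurableU.
have mN : measurable ((~` D) `*` setT `|` setT `*` (~` St)) by exact: measurableU.
have step : ((mu \x nu) Inc <= (mu \x nu) (S (3 / 8)%R) + (mu \x nu) (S (5 / 8)%R))%E.
  apply: le_trans (le_measure _ _ _ cover) _; rewrite ?inE//; first exact: measurableU.
  apply: le_trans (measureU2 _ mS12 mN) _; rewrite -[leRHS]adde0; apply: leeD.
    exact: measureU2.
  apply: le_trans (measureU2 _ mND mNS) _.
  rewrite [X in (X + _ <= _)%E](_ : _ = 0%E); last exact: nullD.
  by rewrite [X in (_ + X <= _)%E](_ : _ = 0%E) ?adde0//; exact: nullS.
apply: le_trans step _; apply: le_trans (leeD (S_le _) (S_le _)) _.
have X0 : (0 <= X)%E by exact: sqrte_ge0.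
rewrite -ge0_muleDl; last 2 first.
- by rewrite -EFinM lee_fin mulr_ge0// ltW.
- by rewrite -EFinM lee_fin mulr_ge0// ltW.
apply: lee_wpmul2r => //; rewrite -!EFinM -EFinD lee_fin; nra.
Qed.
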